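(* Let $G=(V,E)$ be a finite, simple, undirected, connected graph with $n=|V|$ vertices and $m=|E|$ edges. Then Larson's algorithm (described in the context below), which on input $G$ outputs a maximum critical independent set of $G$, can be executed in time $O(m^2)$.
   Context: For a graph $H$, $\alpha(H)$ denotes its independence number, the size of a maximum independent set of $H$. For a vertex $v$, $N(v)$ is its open neighborhood and $N[v]=N(v)\cup\{v\}$; for a vertex set $U$, $N(U)=\bigcup_{u\in U}N(u)$ and $N[U]=N(U)\cup U$. The bi-double graph $B(G)$ of $G=(V,E)$ is the bipartite graph with vertex set $V\cup V'$, where $V'=\{v' : v\in V\}$ is a disjoint copy of $V$, and with an edge $\{u,w'\}$ for $u\in V$, $w'\in V'$ if and only if $\{u,w\}\in E$. For $v\in V$, let $B_v(G)$ denote the graph obtained from $B(G)$ by deleting the vertex set $N[\{v,v'\}]$ (the vertices $v,v'$ and all their neighbors in $B(G)$). Larson's algorithm: initialize $I\leftarrow\emptyset$, construct $B(G)$, and set $V_{\mathrm{remain}}\leftarrow V$. While $V_{\mathrm{remain}}$ is nonempty, pick a vertex $v\in V_{\mathrm{remain}}$; if $\alpha(B(G))=\alpha(B_v(G))+2$, set $I\leftarrow I\cup\{v\}$ and $V_{\mathrm{remain}}\leftarrow V_{\mathrm{remain}}\setminus N[v]$; otherwise set $V_{\mathrm{remain}}\leftarrow V_{\mathrm{remain}}\setminus\{v\}$. Finally return $I$.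
   Formalization: The O(m^2) bound (m ≥ 1) is proved for every order of picks, but the output is shown to be a maximum critical independent set only for suitable picks made in O(m^2); for arbitrary picks this fails (path 1-2-3-4-5-6, picks 2 then 5). *)

(* Defs.v *)
From HB Require Import structures.
From mathcomp Require Import all_boot all_order all_algebra.

Set Implicit Arguments.
Unset Strict Implicit.
Unset Printing Implicit Defensive.

(** * Finite simple graphs *)

Record sgraph := SGraph {
  vert :> finType;
  adj : rel vert;
  adj_sym : symmetric adj;
  adj_irr : irreflexive adj }.

Section GraphNotions.
Variable G : sgraph.
Implicit Types (v : G) (U I : {set G}).

Definition edges : {set {set G}} :=
  [set e | [exists x : G, exists y : G, adj x y && (e == [set x; y])]].

Definition connected : Prop := forall x y : G, connect (@adj G) x y.

Definition nbh v : {set G} := [set w | adj v w].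
Definition cnbh v : {set G} := v |: nbh v.
Definition nbhs U : {set G} := \bigcup_(u in U) nbh u.
Definition cnbhs U : {set G} := nbhs U :|: U.

Definition independent I : bool := [forall x in I, forall y in I, ~~ adj x y].

Definition alpha : nat := \max_(I : {set G} | independent I) #|I|.

Definition diff U : int := (#|U|%:Z - #|nbhs U|%:Z)%R.

Definition critical_independent I : Prop :=
  independent I /\ forall J : {set G}, independent J -> (diff J <= diff I)%R.

Definition max_critical_independent I : Prop :=
  critical_independent I /\
  forall J : {set G}, critical_independent J -> #|J| <= #|I|.

End GraphNotions.

Section Induced.
Variables (G : sgraph) (A : {set G}).

Definition induced_adj : rel {x : G | x \in A} :=
  fun x y => adj (val x) (val y).

Lemma induced_adj_sym : symmetric induced_adj.
Proof. by move=> x y; rewrite /induced_adj adj_sym. Qed.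

Lemma induced_adj_irr : irreflexive induced_adj.
Proof. by move=> x; rewrite /induced_adj adj_irr. Qed.

Definition induced : sgraph := SGraph induced_adj_sym induced_adj_irr.

End Induced.

(** * The bi-double graph: [inl v] is the vertex v, [inr v] its copy v' *)

Section BiDouble.
Variable G : sgraph.

Definition bidouble_adj : rel (G + G)%type := fun a b =>
  match a, b with
  | inl u, inr w | inr w, inl u => adj u w
  | _, _ => false
  end.

Lemma bidouble_adj_sym : symmetric bidouble_adj.
Proof. by case=> [u|u] [w|w]. Qed.

Lemma bidouble_adj_irr : irreflexive bidouble_adj.
Proof. by case. Qed.

Definition bidouble : sgraph := SGraph bidouble_adj_sym bidouble_adj_irr.

Definition bidouble_del (v : G) : sgraph :=
  @induced bidouble (~: @cnbhs bidouble [set inl v; inr v]).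

(** * Larson's algorithm *)

Definition larson_test (v : G) : bool :=
  alpha bidouble == alpha (bidouble_del v) + 2.

(* [larson_loop I R picks J]: started with current set I and V_remain = R,
   the while loop can pick exactly the vertices [picks], in this order, and
   then terminates and returns J. *)
Inductive larson_loop :
    {set G} -> {set G} -> seq G -> {set G} -> Prop :=
| LarsonDone I : larson_loop I set0 [::] I
| LarsonAccept I (R : {set G}) v picks J :
    v \in R -> larson_test v ->
    larson_loop (v |: I) (R :\: cnbh v) picks J ->
    larson_loop I R (v :: picks) J
| LarsonReject I (R : {set G}) v picks J :
    v \in R -> ~~ larson_test v ->
    larson_loop I (R :\ v) picks J ->
    larson_loop I R (v :: picks) J.

Definition larson_run (picks : seq G) (I : {set G}) : Prop :=
  larson_loop set0 [set: G] picks I.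

End BiDouble.

(** * Random access machine programs with unit cost

   Memory consists of natural-number registers and of arrays indexed by
   natural numbers; a program names finitely many of them. The only unit-cost
   arithmetic is successor and predecessor, so t steps increase the largest
   value in memory by at most t, up to the constants of the program: on
   polynomially long runs words of O(log n) bits suffice. *)

Record state := State { reg : nat -> nat; arr : nat -> nat -> nat }.

Definition set_reg (s : state) (x k : nat) : state :=
  State (fun y => if y == x then k else reg s y) (arr s).

Definition set_arr (s : state) (a i k : nat) : state :=
  State (reg s)
    (fun b j => if (b == a) && (j == i) then k else arr s b j).

Inductive cmd :=
| Skip
| Const of nat & nat            (* x := k *)
| Copy of nat & nat             (* x := y *)
| Succ of nat                   (* x := x + 1 *)
| Pred of nat                   (* x := x - 1, truncated at 0 *)
| Get of nat & nat & nat        (* x := a[y] *)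
| Put of nat & nat & nat        (* a[x] := y *)
| Seq of cmd & cmd
| IfLt of nat & nat & cmd & cmd (* if x < y then c1 else c2 *)
| WhileLt of nat & nat & cmd.   (* while x < y do c *)

(* [exec c s t s']: from s, the command c halts in s' after t steps; every
   elementary instruction and every evaluation of a test is one step. *)
Inductive exec : cmd -> state -> nat -> state -> Prop :=
| ExecSkip s : exec Skip s 1 s
| ExecConst x k s : exec (Const x k) s 1 (set_reg s x k)
| ExecCopy x y s : exec (Copy x y) s 1 (set_reg s x (reg s y))
| ExecSucc x s : exec (Succ x) s 1 (set_reg s x (reg s x).+1)
| ExecPred x s : exec (Pred x) s 1 (set_reg s x (reg s x).-1)
| ExecGet x a y s : exec (Get x a y) s 1 (set_reg s x (arr s a (reg s y)))
| ExecPut a x y s :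
    exec (Put a x y) s 1 (set_arr s a (reg s x) (reg s y))
| ExecSeq c1 c2 s t1 s1 t2 s2 :
    exec c1 s t1 s1 -> exec c2 s1 t2 s2 -> exec (Seq c1 c2) s (t1 + t2) s2
| ExecIfT x y c1 c2 s t s' :
    reg s x < reg s y -> exec c1 s t s' -> exec (IfLt x y c1 c2) s t.+1 s'
| ExecIfF x y c1 c2 s t s' :
    reg s y <= reg s x -> exec c2 s t s' -> exec (IfLt x y c1 c2) s t.+1 s'
| ExecWhileF x y c s : reg s y <= reg s x -> exec (WhileLt x y c) s 1 s
| ExecWhileT x y c s t1 s1 t2 s2 :
    reg s x < reg s y -> exec c s t1 s1 -> exec (WhileLt x y c) s1 t2 s2 ->
    exec (WhileLt x y c) s (t1 + t2).+1 s2.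

(** * Input and output conventions *)

Section InputOutput.
Variable G : sgraph.

(* The vertices are numbered 0, ..., n-1 in an arbitrary way. *)
Definition numbering (lab : G -> nat) : Prop :=
  injective lab /\ forall v, lab v < #|G|.

(* Item i of ls lists, in any order, the numbers of the neighbours of the
   vertex numbered i. *)
Definition adjacency_lists (lab : G -> nat) (ls : seq (seq nat)) : Prop :=
  size ls = #|G| /\
  forall v, perm_eq (nth [::] ls (lab v)) [seq lab w | w in nbh v].

(* On halting, entry i of array 3 is 1 if the vertex numbered i is in I and 0
   otherwise. *)
Definition outputs (lab : G -> nat) (I : {set G}) (s : state) : Prop :=
  forall v, arr s 3 (lab v) = (v \in I).

End InputOutput.

(* Register 0 holds n, and the adjacency lists are stored one after the other in
   array 1, list i occupying the positions from entry i (included) to entry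
   i+1 (excluded) of array 0. Register 1 and array 2 hold an auxiliary list of
   vertex numbers (its length and its items). The rest of the memory is 0. *)
Definition input (ls : seq (seq nat)) (aux : seq nat) : state :=
  State
    (nth 0 [:: size ls; size aux])
    (fun a => nth 0 (nth [::]
       [:: 0 :: scanl addn 0 (map size ls); flatten ls; aux] a)).

(* Main.v *)
Require Import Defs.
From mathcomp Require Import all_boot all_order all_algebra zify.

Set Implicit Arguments.
Unset Strict Implicit.
Unset Printing Implicit Defensive.

(** Call a set X critical if |X| - |N(X)| is maximum. A maximum independent set
    of the bi-double graph is X on one side and V \ N(X) on the other with X
    critical, so Larson's test accepts v iff some critical X contains v while
    v is not in N(X). Fix a maximum matching of the bi-double graph. The critical
    sets are the sets that contain all free vertices u and, with u, the mate of
    every neighbour of u, all these neighbours being matched. The test for v is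
    therefore a single breadth-first search, run as if v and v' were both free:
    v is accepted iff no free vertex of the other side is reached. The matching
    comes from n rounds of search and augmentation; a search is linear in n + m,
    and n <= 2 m since no vertex is isolated, so O(n) searches take O(m^2).

    Accepted vertices need not form a critical set for every order of the picks:
    on the path a-b-c-d-e-f, picking b and then e returns {b, e}. The second
    program keeps the accepted vertices free in the later searches, which accepts
    v iff the accepted set together with v extends to a critical independent set.
    The result I is inclusion-maximal. If I and K are critical independent sets,
    so is I u (K \ N(I)), because critical sets form a lattice that contains
    V \ N(I); hence K \ N(I) is inside I, and a Hall argument gives |K| <= |I|.
    Picking I first is a run of the algorithm that returns I. *)

(** * Running commands within a time bound *)

Fixpoint wreg (c : cmd) : seq nat :=
  match c with
  | Skip | Put _ _ _ => [::]
  | Const x _ | Copy x _ | Succ x | Pred x | Get x _ _ => [:: x]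
  | Seq c1 c2 | IfLt _ _ c1 c2 => wreg c1 ++ wreg c2
  | WhileLt _ _ c1 => wreg c1
  end.

Fixpoint warr (c : cmd) : seq nat :=
  match c with
  | Put a _ _ => [:: a]
  | Seq c1 c2 | IfLt _ _ c1 c2 => warr c1 ++ warr c2
  | WhileLt _ _ c1 => warr c1
  | _ => [::]
  end.

(** Determined by the text of [c], so loop invariants need not mention memory that the loop never
    writes. *)
Definition frame (c : cmd) (s s' : state) : Prop :=
  (forall x, x \notin wreg c -> reg s' x = reg s x) /\
  (forall a, a \notin warr c -> arr s' a = arr s a).

Lemma frame_refl c s : frame c s s.
Proof. by []. Qed.

Lemma frame_trans c s1 s2 s3 : frame c s1 s2 -> frame c s2 s3 -> frame c s1 s3.
Proof.
move=> [r1 a1] [r2 a2]; split=> [x xc|a ac]; first by rewrite r2 ?r1.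
by rewrite a2 ?a1.
Qed.

Lemma frame_sub c c' s s' :
  {subset wreg c <= wreg c'} -> {subset warr c <= warr c'} ->
  frame c s s' -> frame c' s s'.
Proof.
move=> subr suba [r1 a1]; split=> [x xc|a ac].
  by apply: r1; apply: contra xc; apply: subr.
by apply: a1; apply: contra ac; apply: suba.
Qed.

Lemma exec_frame c s t s' : exec c s t s' -> frame c s s'.
Proof.
elim=> {c s t s'} /=.
- by move=> s.
- by move=> x k s; split=> //= y; rewrite inE => /negbTE->.
- by move=> x k s; split=> //= y; rewrite inE => /negbTE->.
- by move=> x s; split=> //= y; rewrite inE => /negbTE->.
- by move=> x s; split=> //= y; rewrite inE => /negbTE->.
- by move=> x a y s; split=> //= z; rewrite inE => /negbTE->.
- by move=> a x y s; split=> //= b; rewrite inE => /negbTE->.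
- move=> c1 c2 s t1 s1 t2 s2 _ f1 _ f2; apply: (@frame_trans _ _ s1).
    by apply: frame_sub f1 => x; rewrite /= mem_cat => ->.
  by apply: frame_sub f2 => x; rewrite /= mem_cat orbC => ->.
- move=> x y c1 c2 s t s' _ _.
  by apply: frame_sub => z; rewrite /= mem_cat => ->.
- move=> x y c1 c2 s t s' _ _.
  by apply: frame_sub => z; rewrite /= mem_cat orbC => ->.
- by move=> x y c s _; apply: frame_refl.
- move=> x y c s t1 s1 t2 s2 _ _ f1 _ f2; exact: frame_trans f1 f2.
Qed.

Definition runs (c : cmd) (s : state) (T : nat) (Q : state -> Prop) : Prop :=
  exists t s', [/\ exec c s t s', t <= T & Q s'].

Lemma runs_weaken c s T T' (Q Q' : state -> Prop) :
  runs c s T Q -> T <= T' -> (forall s', frame c s s' -> Q s' -> Q' s') ->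
  runs c s T' Q'.
Proof.
move=> [t [s' [e tT Qs']]] TT' QQ'; exists t, s'; split=> //.
  exact: leq_trans TT'.
exact: QQ' (exec_frame e) Qs'.
Qed.

Lemma runs_seq c1 c2 s T1 T2 (Q : state -> Prop) :
  runs c1 s T1 (fun s1 => runs c2 s1 T2 Q) -> runs (Seq c1 c2) s (T1 + T2) Q.
Proof.
move=> [t1 [s1 [e1 l1 [t2 [s2 [e2 l2 Qs2]]]]]]; exists (t1 + t2), s2.
by split=> //; [apply: ExecSeq e1 e2 | apply: leq_add].
Qed.

Fixpoint loop_free (c : cmd) : bool :=
  match c with
  | Seq c1 c2 | IfLt _ _ c1 c2 => loop_free c1 && loop_free c2
  | WhileLt _ _ _ => false
  | _ => true
  end.

(** Loops get a dummy value: [eval] serves for loop-free commands, whose final state is then found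
    by computation. *)
Fixpoint eval (c : cmd) (s : state) : state :=
  match c with
  | Skip | WhileLt _ _ _ => s
  | Const x k => set_reg s x k
  | Copy x y => set_reg s x (reg s y)
  | Succ x => set_reg s x (reg s x).+1
  | Pred x => set_reg s x (reg s x).-1
  | Get x a y => set_reg s x (arr s a (reg s y))
  | Put a x y => set_arr s a (reg s x) (reg s y)
  | Seq c1 c2 => eval c2 (eval c1 s)
  | IfLt x y c1 c2 => if reg s x < reg s y then eval c1 s else eval c2 s
  end.

Fixpoint cmd_size (c : cmd) : nat :=
  match c with
  | Seq c1 c2 => cmd_size c1 + cmd_size c2
  | IfLt _ _ c1 c2 => (cmd_size c1 + cmd_size c2).+1
  | _ => 1
  end.

Lemma runs_eval c s (Q : state -> Prop) :
  loop_free c -> Q (eval c s) -> runs c s (cmd_size c) Q.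
Proof.
suff E : loop_free c ->
    exists2 t, exec c s t (eval c s) & t <= cmd_size c.
  by move=> /E[t e lt] Qs; exists t, (eval c s).
elim: c s {Q} => /=; do ?by move=> *; exists 1 => //; constructor.
  move=> c1 IH1 c2 IH2 s /andP[/(IH1 s)[t1 e1 l1]].
  move=> /(IH2 (eval c1 s))[t2 e2 l2]; exists (t1 + t2); last by rewrite leq_add.
  exact: ExecSeq e1 e2.
move=> x y c1 IH1 c2 IH2 s /andP[/(IH1 s)[t1 e1 l1] /(IH2 s)[t2 e2 l2]].
case: (ltnP (reg s x)) => xy.
  by exists t1.+1; [apply: ExecIfT | rewrite ltnS; apply: leq_trans l1 _; lia].
by exists t2.+1; [apply: ExecIfF | rewrite ltnS; apply: leq_trans l2 _; lia].
Qed.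

(* The first argument of [I] is the time that the rest of the loop may take. *)
Lemma runs_while x y c (I : nat -> state -> Prop) T s0 :
  I T s0 ->
  (forall T1 s, frame c s0 s -> I T1 s -> reg s x < reg s y ->
     exists T2 T3, T2 + T3 < T1 /\ runs c s T2 (I T3)) ->
  runs (WhileLt x y c) s0 T.+1
    (fun s => reg s y <= reg s x /\ exists T', I T' s).
Proof.
move=> IT step.
suff H s : I T s -> frame c s0 s -> runs (WhileLt x y c) s T.+1
    (fun s => reg s y <= reg s x /\ exists T', I T' s).
  exact: H IT (frame_refl c s0).
elim/ltn_ind: T s {IT} => T IH s IT fs.
case: (ltnP (reg s x) (reg s y)) => xy; last first.
  by exists 1, s; split=> //; [apply: ExecWhileF | split=> //; exists T].
have [T2 [T3 [lt [t1 [s1 [e1 l1 I1]]]]]] := step _ _ fs IT xy.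
have [||t2 [s2 [e2 l2 [Q1 Q2]]]] := IH T3 _ s1 I1; first by lia.
  exact: frame_trans fs (exec_frame e1).
exists (t1 + t2).+1, s2; split=> //; first exact: ExecWhileT e1 e2.
by lia.
Qed.

(** This is [runs_while] with remaining time [(K - k) * d.+1]: a round costs its body and one
    test. *)
Lemma runs_for x y c (I : nat -> state -> Prop) K d s0 :
  I 0 s0 ->
  (forall k s, k <= K -> frame c s0 s -> I k s -> (reg s x < reg s y) = (k < K)) ->
  (forall k s, k < K -> frame c s0 s -> I k s -> runs c s d (I k.+1)) ->
  runs (WhileLt x y c) s0 (K * d.+1).+1 (I K).
Proof.
move=> I0 test step.
have := @runs_while x y c
  (fun T s => exists2 k, k <= K /\ frame c s0 s & T = (K - k) * d.+1 /\ I k s)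
  (K * d.+1) s0.
case=> [|T s fs [k [kK fk] [-> Ik]]|t [s [e lt [xy [T' [k [kK fk] [_ Ik]]]]]]].
- by exists 0 => //; rewrite subn0.
- rewrite (test k) // => kltK; exists d, ((K - k.+1) * d.+1); split.
    by rewrite -(subnSK kltK) mulSn; lia.
  apply: runs_weaken (step _ _ kltK fk Ik) (leqnn _) _ => s' fs' I'.
  by exists k.+1 => //; split=> //; apply: frame_trans fs'.
- have kE : k = K by have := test _ _ kK fk Ik; lia.
  by exists t, s; split; rewrite -?kE // kE.
Qed.

(** * The programs *)

Local Notation "c1 ;; c2" := (Seq c1 c2) (at level 60, right associativity).

(* Arrays [aL] and [aR] hold the matching between the two copies of the vertex
   set: 0 for a free vertex, and 1 + the number of the mate otherwise. *)
Local Notation rN := 0.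
Local Notation rLen := 1.
Local Notation rZ := 2.
Local Notation rI := 3.
Local Notation rTail := 4.
Local Notation rHead := 5.
Local Notation rU := 6.
Local Notation rE := 7.
Local Notation rEnd := 8.
Local Notation rW := 9.
Local Notation rX := 10.
Local Notation rT := 11.
Local Notation rWF := 12.
Local Notation rFU := 13.
Local Notation rV := 14.
Local Notation rK := 15.
Local Notation rS1 := 16.
Local Notation rS2 := 17.

Local Notation aOff := 0.
Local Notation aAdj := 1.
Local Notation aAux := 2.
Local Notation aOut := 3.
Local Notation aL := 4.
Local Notation aR := 5.
Local Notation aIn := 6.
Local Notation aQ := 7.
Local Notation aPar := 8.

Definition init_body : cmd :=
  Get rX aL rI;; Put aIn rI rZ;;
  IfLt rZ rX Skip
    (Const rT 1;; Put aIn rI rT;; Put aQ rTail rI;; Succ rTail);;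
  Succ rI.

(* [rWF] is 1 + the number of some free right vertex reached so far, or 0, and
   [rFU] the left vertex it was reached from. *)
Definition scan_edge : cmd :=
  Get rW aAdj rE;; Succ rE;; Get rX aR rW;;
  IfLt rZ rX
    (Pred rX;; Get rT aIn rX;;
     IfLt rZ rT Skip
       (Const rT 1;; Put aIn rX rT;; Put aPar rX rU;; Put aQ rTail rX;;
        Succ rTail))
    (Copy rWF rW;; Succ rWF;; Copy rFU rU).

Definition scan_vertex : cmd :=
  (Get rU aQ rHead;; Succ rHead;; Get rE aOff rU;;
   Copy rT rU;; Succ rT;; Get rEnd aOff rT);;
  WhileLt rE rEnd scan_edge.

Definition search : cmd :=
  (Const rWF 0;; Const rTail 0;; Const rHead 0;; Const rI 0);;
  WhileLt rI rN init_body;;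
  WhileLt rHead rTail scan_vertex.

(* An unsuccessful search leaves 0 in [rWF], and [augment] does nothing. *)
Definition augment_body : cmd :=
  Get rX aL rFU;; Put aL rFU rWF;; Copy rT rFU;; Succ rT;; Pred rWF;;
  Put aR rWF rT;; Copy rWF rX;; Get rFU aPar rFU.

Definition augment : cmd := WhileLt rZ rWF augment_body.

Definition matching_body : cmd := (search;; augment);; Succ rK.

Definition matching : cmd := Const rK 0;; WhileLt rK rN matching_body.

Definition restore : cmd := Put aL rV rS1;; Put aR rV rS2.

Definition test : cmd :=
  (Get rS1 aL rV;; Get rS2 aR rV;; Put aL rV rZ;; Put aR rV rZ);; search.

(* With [b = false] the cleared entries of an accepted vertex stay cleared. *)
Definition decide (b : bool) : cmd :=
  IfLt rZ rWF restore
    (Const rT 1;; Put aOut rV rT;; if b then restore else Skip);;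
  Succ rK.

Definition select_body (b : bool) : cmd :=
  (if b then Get rV aAux rK else Copy rV rK);; test;; decide b.

Definition select (b : bool) : cmd :=
  Const rK 0;; WhileLt rK (if b then rLen else rN) (select_body b).

(** * Memory layout and breadth-first search *)

Section Search.

Variable ls : seq (seq nat).
Local Notation n := (size ls).
Local Notation nb := (nth [::] ls).
Hypothesis ls_lt : forall u w, w \in nb u -> w < n.

Definition stored (s : state) : Prop :=
  [/\ reg s rN = n, reg s rZ = 0,
      arr s aOff = nth 0 (0 :: scanl addn 0 (shape ls))
    & arr s aAdj = nth 0 (flatten ls)].

(** A boolean on the program text, so that each use is proved by [isT]. *)
Definition keeps_input (c : cmd) : bool :=
  [&& rN \notin wreg c, rZ \notin wreg c, aOff \notin warr c
    & aAdj \notin warr c].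

Lemma stored_frame c s s' :
  keeps_input c -> frame c s s' -> stored s -> stored s'.
Proof.
case/and4P=> i1 i2 i3 i4 [fr fa] [e1 e2 e3 e4].
by split; rewrite ?fr ?fa.
Qed.

(** [scanl] leaves out its initial value; the 0 put in front restores it and makes the case [u = n]
    meaningful. *)
Lemma offsetE u : u <= n ->
  nth 0 (0 :: scanl addn 0 (shape ls)) u = sumn (take u (shape ls)).
Proof.
case: u => [|u] un /=; first by rewrite take0.
by rewrite nth_scanl ?size_map // sumnE foldlE big_cons.
Qed.

Lemma offsetS u : u < n ->
  sumn (take u.+1 (shape ls)) = sumn (take u (shape ls)) + size (nb u).
Proof.
move=> un; rewrite (take_nth 0) ?size_map // -cats1 sumn_cat /= addn0.
by rewrite (nth_map [::]).
Qed.

Lemma flatten_nth u j : u < n -> j < size (nb u) ->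
  nth 0 (flatten ls) (sumn (take u (shape ls)) + j) = nth 0 (nb u) j.
Proof.
move=> un ju; have ju' : j < nth 0 (shape ls) u by rewrite (nth_map [::]).
by rewrite nth_flatten -[_ + j]/(flatten_index _ _ _) flatten_indexKl //
   flatten_indexKr.
Qed.

(** Entries of [aIn] may be left over from an earlier search; [d] counts those already reset, and is
    [n] once the initial loop is over. *)
Definition queued (d : nat) (q : seq nat) (s : state) : Prop :=
  [/\ uniq q, forall x, x \in q -> x < n, reg s rTail = size q,
      forall i, i < size q -> arr s aQ i = nth 0 q i
    & forall x, x < d -> arr s aIn x = (x \in q)].

(* [D u w] says that the edge from [u] to [w] has been scanned. *)
Definition explored (ml mr : nat -> nat) (q : seq nat)
    (D : nat -> nat -> Prop) (s : state) : Prop :=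
  [/\ forall u, u < n -> ml u = 0 -> u \in q,
      forall x, x \in q -> ml x = 0 \/
        arr s aPar x \in take (index x q) q /\
        exists2 w, w \in nb (arr s aPar x) & mr w = x.+1,
      forall w, reg s rWF = w.+1 ->
        [/\ reg s rFU \in q, w \in nb (reg s rFU) & mr w = 0]
    & forall u w, D u w ->
        (mr w = 0 -> 0 < reg s rWF) /\ forall x, mr w = x.+1 -> x \in q].

Lemma explored_sub ml mr q D D' s :
  (forall u w, D' u w -> D u w) -> explored ml mr q D s -> explored ml mr q D' s.
Proof. by move=> DD' [e1 e2 e3 e4]; split=> // u w /DD'/e4. Qed.

Definition edge_cost := (cmd_size scan_edge).+1.

Lemma scan_edges_spec D u q s0 :
  stored s0 -> u \in q -> reg s0 rU = u ->
  reg s0 rE = sumn (take u (shape ls)) ->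
  reg s0 rEnd = sumn (take u.+1 (shape ls)) ->
  (forall w, 0 < arr s0 aR w -> (arr s0 aR w).-1 < n) ->
  queued n q s0 -> explored (arr s0 aL) (arr s0 aR) q D s0 ->
  runs (WhileLt rE rEnd scan_edge) s0 (size (nb u) * edge_cost).+1
    (fun s => exists q', queued n (q ++ q') s /\
       explored (arr s0 aL) (arr s0 aR) (q ++ q')
         (fun u' w => D u' w \/ u' = u /\ w \in nb u) s).
Proof.
move=> st0 uq uE eE eEnd mr_lt q0 x0.
have un : u < n by case: q0 => _ /(_ _ uq).
set ml := arr s0 aL in x0 *; set mr := arr s0 aR in x0 mr_lt *.
pose I j s := reg s rE = sumn (take u (shape ls)) + j /\
  exists q', queued n (q ++ q') s /\
    explored ml mr (q ++ q')
      (fun u' w => D u' w \/ u' = u /\ w \in take j (nb u)) s.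
have := @runs_for rE rEnd scan_edge I (size (nb u)) (cmd_size scan_edge) s0.
case=> [|j s jK [fr _] [eEs _]|j s jK fs [eEs [q' [Q X]]]|
        t [s [e lt [_ [q' [Q X]]]]]].
- split; first by rewrite addn0.
  exists [::]; rewrite cats0; split=> //.
  by apply: explored_sub x0 => v w; rewrite take0 => -[//|[]].
- by rewrite eEs fr // eEnd offsetS // ltn_add2l.
- have [r0 rz _ a1] := stored_frame (isT : keeps_input scan_edge) fs st0.
  have [fr fa] := fs.
  have uEs : reg s rU = u by rewrite fr.
  have mrE : arr s aR = mr by rewrite fa.
  set w := nth 0 (nb u) j.
  have wE : arr s aAdj (reg s rE) = w by rewrite a1 eEs flatten_nth.
  have wnb : w \in nb u by apply: mem_nth.
  have takeE : take j.+1 (nb u) = rcons (take j (nb u)) w by rewrite (take_nth 0).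
  have uqq : u \in q ++ q' by rewrite mem_cat uq.
  apply: runs_eval => //=; rewrite wE rz mrE uEs.
  have [Qu Qlt Qt Qa Qi] := Q; have [X1 X2 X3 X4] := X.
  (* Three cases, in this order: [w] is free and gets recorded, its mate is already in the queue, or
     its mate is enqueued. *)
  case: ltnP => [mrw|]; last first.
    rewrite leqn0 => /eqP mrw; split; first by rewrite /= eEs addnS.
    exists q'; split; split=> //=; first by move=> v [<-].
    move=> v y; rewrite takeE mem_rcons inE => -[Dy|[vu /orP[/eqP->|yt]]].
    + by have [_ h] := X4 v y (or_introl Dy).
    + by rewrite mrw.
    + by have [_ h] := X4 v y (or_intror (conj vu yt)).
  have xn := mr_lt _ mrw; set x := (mr w).-1 in xn *.
  have mrx : mr w = x.+1 by rewrite /x prednK.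
  rewrite /= Qi //; case: ltnP => [xq|].
    split; first by rewrite /= eEs addnS.
    have {}xq : x \in q ++ q' by case: (x \in _) xq.
    exists q'; split; split=> //= v y.
    rewrite takeE mem_rcons inE => -[Dy|[vu /orP[/eqP->|yt]]].
    + exact: X4 (or_introl Dy).
    + by rewrite mrx; split=> // x' [<-].
    + exact: X4 (or_intror (conj vu yt)).
  rewrite leqn0 eqb0 => xq.
  split; first by rewrite /= eEs addnS.
  exists (rcons q' x); rewrite -rcons_cat.
  split; split=> /=.
  + by rewrite rcons_uniq xq.
  + by move=> y; rewrite mem_rcons inE => /orP[/eqP->|/Qlt].
  + by rewrite Qt size_rcons.
  + move=> i; rewrite size_rcons ltnS nth_rcons Qt leq_eqVlt.
    by case: eqVneq => [->|_] /= => [|h]; rewrite ?ltnn // h Qa.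
  + move=> y yn; rewrite mem_rcons inE.
    by case: eqVneq => //= _; rewrite Qi.
  + by move=> v vn mlv; rewrite mem_rcons inE X1 ?orbT.
  (* The new vertex stands at the end of the queue, hence after its parent [u]. *)
  + have xi : index x (rcons (q ++ q') x) = size (q ++ q').
      by rewrite -cats1 index_cat (negbTE xq) /= eqxx addn0.
    move=> y; rewrite mem_rcons inE; case: eqVneq => [->|yx] /= yq.
      rewrite xi -cats1 take_size_cat //; right; split=> //; by exists w.
    have [->|[h1 h2]] := X2 _ yq; [by left|right; split=> //].
    by rewrite -cats1 index_cat yq takel_cat // index_size.
  + by move=> v /X3[h1 h2 h3]; split=> //; rewrite mem_rcons inE h1 orbT.
  + move=> v y; rewrite takeE mem_rcons inE => -[Dy|[vu /orP[/eqP->|yt]]].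
    * have [h1 h2] := X4 v y (or_introl Dy); split=> // z /h2.
      by rewrite mem_rcons inE orbC => ->.
    * by rewrite mrx; split=> // z [<-]; rewrite mem_rcons mem_head.
    * have [h1 h2] := X4 v y (or_intror (conj vu yt)); split=> // z /h2.
      by rewrite mem_rcons inE orbC => ->.
- exists t, s; split=> //; exists q'; split=> //.
  by apply: explored_sub X => v w; rewrite take_size.
Qed.

(** Besides its edges a vertex costs 6 instructions, the last test of the inner loop and one test of
    the outer loop. *)
Definition vertex_cost := edge_cost + 8.
Definition graph_size := \sum_(u <- iota 0 n) (size (nb u)).+1.

(** No vertex is enqueued twice, so a search pays for each adjacency list at most once. *)
Lemma sum_queue_le q : uniq q -> (forall x, x \in q -> x < n) ->
  \sum_(u <- q) (size (nb u)).+1 <= graph_size.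
Proof.
move=> Uq ltq; rewrite (perm_big [seq u <- iota 0 n | u \in q]) /=; last first.
  apply: uniq_perm; rewrite ?filter_uniq ?iota_uniq // => x.
  by rewrite mem_filter mem_iota add0n; case: (boolP (x \in q)) => // /ltq ->.
rewrite big_filter /graph_size [leqRHS](bigID (mem q)) /=.
exact: leq_addr.
Qed.

Definition search_done (ml mr : nat -> nat) (s : state) : Prop :=
  exists q, queued n q s /\
    explored ml mr q (fun u w => u \in q /\ w \in nb u) s.

Lemma scan_vertices_spec q0 s0 :
  stored s0 -> reg s0 rHead = 0 ->
  (forall w, 0 < arr s0 aR w -> (arr s0 aR w).-1 < n) ->
  queued n q0 s0 ->
  explored (arr s0 aL) (arr s0 aR) q0 (fun _ _ => False) s0 ->
  runs (WhileLt rHead rTail scan_vertex) s0 (vertex_cost * graph_size).+1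
    (search_done (arr s0 aL) (arr s0 aR)).
Proof.
move=> st0 h0 mr_lt Q0 X0.
set ml := arr s0 aL in X0 *; set mr := arr s0 aR in X0 mr_lt *.
(* Amortization: the time left plus the charges of the [h] vertices already scanned is the whole
   budget. *)
pose I T s := exists q h, [/\ reg s rHead = h, h <= size q, queued n q s,
   explored ml mr q (fun u w => u \in take h q /\ w \in nb u) s &
   T + vertex_cost * \sum_(u <- take h q) (size (nb u)).+1
     = vertex_cost * graph_size].
have := @runs_while rHead rTail scan_vertex I (vertex_cost * graph_size) s0.
case=> [|T s fs [q [h [hE hq Q X TE]]]|t [s [e lt [ht [T' [q [h [hE hq Q X _]]]]]]]].
- exists q0, 0; split=> //; last by rewrite take0 big_nil muln0 addn0.
  by apply: explored_sub X0 => u w; rewrite take0; case.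
- have [Qu Qlt Qt Qa Qi] := Q.
  rewrite Qt hE => {}hq.
  set u := nth 0 q h; have uq : u \in q by apply: mem_nth.
  have un := Qlt _ uq.
  have takeE : take h.+1 q = rcons (take h q) u by rewrite (take_nth 0).
  have le : \sum_(u <- take h.+1 q) (size (nb u)).+1 <= graph_size.
    apply: sum_queue_le; first exact: take_uniq.
    by move=> x /mem_take/Qlt.
  have sumE : \sum_(u <- take h.+1 q) (size (nb u)).+1 =
      \sum_(u <- take h q) (size (nb u)).+1 + (size (nb u)).+1.
    by rewrite takeE -cats1 big_cat big_seq1.
  exists (6 + (size (nb u) * edge_cost).+1),
    (vertex_cost * (graph_size - \sum_(u <- take h.+1 q) (size (nb u)).+1)).
  split.
    move: le TE; rewrite sumE => /subnKC; move: (_ - _) => r <-.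
    by rewrite /vertex_cost; move: edge_cost => c; lia.
  have st := stored_frame (isT : keeps_input scan_vertex) fs st0.
  have [r0 rz o1 a1] := st; have [fr fa] := fs.
  have mlE : arr s aL = ml by rewrite fa.
  have mrE : arr s aR = mr by rewrite fa.
  apply: runs_seq; apply: runs_eval => //=.
  have uE : arr s aQ (reg s rHead) = u by rewrite hE Qa.
  rewrite !uE o1.
  set s1 := set_reg _ rEnd _.
  have := @scan_edges_spec (fun u w => u \in take h q /\ w \in nb u) u q s1.
  case=> //.
  + by rewrite /= offsetE // ltnW.
  + by rewrite -offsetE.
  + by rewrite /= mrE.
  + by rewrite /= mlE mrE.
  move=> t [s2 [e lt [q' [Q' X']]]]; exists t, s2; split=> //.
  have [fr2 _] := exec_frame e.
  have hs : h.+1 <= size (q ++ q') by rewrite size_cat ltn_addr.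
  exists (q ++ q'), h.+1; split=> //.
  + by rewrite fr2 //= hE.
  + rewrite /= mlE mrE in X'; apply: explored_sub X' => v w.
    rewrite takel_cat // takeE mem_rcons inE => -[/orP[/eqP->|vt] wv].
      by right.
    by left.
  + rewrite takel_cat // -mulnDr subnK //.
- exists t, s; split=> //; exists q; split=> //.
  have hs : size q <= h by case: Q => _ _ <- _ _; rewrite -hE.
  by apply: explored_sub X => u w; rewrite take_oversize.
Qed.

Lemma init_spec s0 :
  stored s0 -> reg s0 rI = 0 -> reg s0 rTail = 0 -> reg s0 rWF = 0 ->
  runs (WhileLt rI rN init_body) s0 (n * (cmd_size init_body).+1).+1
    (fun s => exists q, queued n q s /\
       explored (arr s0 aL) (arr s0 aR) q (fun _ _ => False) s).
Proof.
move=> st0 i0 t0 w0; set ml := arr s0 aL.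
pose I k s := reg s rI = k /\ queued k [seq u <- iota 0 k | ml u == 0] s.
have := @runs_for rI rN init_body I n (cmd_size init_body) s0.
case=> [|k s kn [fr _] [iE _]|k s kn fs [iE [Qu Qlt Qt Qa Qi]]|
        t [s [e lt [iE Q]]]].
- by [].
- by case: st0 => n0 _ _ _; rewrite iE fr // n0.
- have [rn rz _ _] := stored_frame (isT : keeps_input init_body) fs st0.
  have [fr fa] := fs.
  have mlE : arr s aL = ml by rewrite fa.
  have kq : k \notin [seq u <- iota 0 k | ml u == 0].
    by rewrite mem_filter mem_iota add0n ltnn !andbF.
  apply: runs_eval => //=; rewrite iE mlE rz.
  have qE : [seq u <- iota 0 k.+1 | ml u == 0] =
      [seq u <- iota 0 k | ml u == 0] ++ (if ml k == 0 then [:: k] else [::]).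
    by rewrite -addn1 iotaD add0n filter_cat.
  rewrite /I qE.
  case: ltnP => [|]; rewrite ?leqn0 ?lt0n.
    move=> /negbTE mk; rewrite mk cats0; split=> /=; first by rewrite iE.
    split=> //= x; rewrite ltnS leq_eqVlt; case: eqVneq => [->|_] //=.
      by rewrite (negbTE kq).
    exact: Qi.
  move=> mk; rewrite mk cats1; split=> /=; first by rewrite iE.
  split=> /=.
  + by rewrite rcons_uniq kq.
  + by move=> y; rewrite mem_rcons inE => /orP[/eqP->|/Qlt].
  + by rewrite Qt size_rcons.
  + move=> i; rewrite size_rcons ltnS nth_rcons Qt leq_eqVlt.
    by case: eqVneq => [->|_] /= => [|h]; rewrite ?ltnn // h Qa.
  + move=> x; rewrite ltnS leq_eqVlt mem_rcons inE.
    by case: eqVneq => [->|_] //= /Qi ->.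
- exists t, s; split=> //; exists [seq u <- iota 0 n | ml u == 0]; split=> //.
  have [fr fa] := exec_frame e; split=> //.
  + by move=> u un mu; rewrite mem_filter mu mem_iota.
  + by move=> x; rewrite mem_filter => /andP[/eqP]; left.
  + by move=> w; rewrite fr // w0.
Qed.

Definition search_cost :=
  n * (cmd_size init_body).+1 + vertex_cost * graph_size + 6.

Lemma search_spec s0 :
  stored s0 -> (forall w, 0 < arr s0 aR w -> (arr s0 aR w).-1 < n) ->
  runs search s0 search_cost (search_done (arr s0 aL) (arr s0 aR)).
Proof.
move=> st0 mr_lt.
suff: runs search s0 (4 + ((n * (cmd_size init_body).+1).+1 +
    (vertex_cost * graph_size).+1)) (search_done (arr s0 aL) (arr s0 aR)).
  by move=> /runs_weaken; apply=> //; rewrite /search_cost; lia.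
apply: runs_seq; apply: runs_eval => //=.
set s1 := set_reg _ rI 0.
have st1 : stored s1 by case: st0.
apply: runs_seq.
have := init_spec st1 erefl erefl erefl.
move=> /runs_weaken; apply=> // s f [q [Q X]].
have [fr fa] := f.
have := @scan_vertices_spec q s; rewrite !fa //; apply=> //.
  exact: stored_frame f st1.
by rewrite fr.
Qed.

(** [A] contains all that alternating paths from free left vertices reach, and no free right vertex
    is adjacent to it: it certifies that a matching is maximum. Entries are shifted by 1, so
    [(mr w).-1] is the mate of [w]. *)
Definition stable (ml mr : nat -> nat) (A : pred nat) : Prop :=
  (forall u, u < n -> ml u = 0 -> A u) /\
  (forall u w, u < n -> A u -> w \in nb u -> 0 < mr w /\ A (mr w).-1).

Lemma stable_eq ml mr ml' mr' A :
  ml =1 ml' -> mr =1 mr' -> stable ml mr A -> stable ml' mr' A.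
Proof.
move=> el er [s1 s2]; split=> [u un|u w un Au wu]; first by rewrite -el; apply: s1.
by rewrite -er; apply: s2 wu.
Qed.

(** If no free right vertex was met, the queue itself is stable. Conversely every stable set
    contains the queue, by induction along it since parents come earlier, and so excludes a free
    right neighbour. *)
Lemma search_doneP ml mr s :
  search_done ml mr s -> reg s rWF = 0 <-> exists A, stable ml mr A.
Proof.
move=> [q [[Qu Qlt Qt Qa Qi] [X1 X2 X3 X4]]]; split=> [w0|[A [A1 A2]]].
  exists (mem q); split=> [u un mu|u w un uq wu]; first exact: X1.
  have [] := X4 _ _ (conj uq wu); rewrite w0.
  by case: (mr w) => [|x] h1 h2; [have := h1 erefl | split=> //; apply: h2].
have qA : forall x, x \in q -> A x.
  move=> x; have [k] := ubnP (index x q); elim: k x => // k IH x xk xq.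
  have [mx|[px [w wp mw]]] := X2 _ xq; first exact: A1 (Qlt _ xq) mx.
  have pq := mem_take px.
  have lt : index (arr s aPar x) q < index x q.
    exact: index_ltn px.
  have Ap : A (arr s aPar x) by apply: IH pq; lia.
  by have [_] := A2 _ _ (Qlt _ pq) Ap wp; rewrite mw.
case E : (reg s rWF) => [//|w]; have [h1 h2 h3] := X3 _ E.
by have [] := A2 _ _ (Qlt _ h1) (qA _ h1) h2; rewrite h3.
Qed.

(** * Matchings and augmentation *)

Definition matched (ml mr : nat -> nat) : Prop :=
  [/\ forall u w, u < n -> w < n -> ml u = w.+1 <-> mr w = u.+1,
      forall u w, u < n -> ml u = w.+1 -> w \in nb u
    & forall w u, mr w = u.+1 -> u < n].

Definition upd (f : nat -> nat) (i k : nat) : nat -> nat :=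
  fun j => if j == i then k else f j.

Definition free (ml : nat -> nat) : nat := \sum_(u <- iota 0 n) (ml u == 0).

Lemma free_upd ml u k : u < n ->
  free (upd ml u k) + (ml u == 0) = free ml + (k == 0).
Proof.
move=> un; have ui : u \in iota 0 n by rewrite mem_iota.
rewrite /free !(bigD1_seq u ui (iota_uniq _ _)) /= /upd eqxx.
set S := \sum_(i <- _ | _) _; set S' := \sum_(i <- _ | _) _.
suff -> : S = S' by lia.
by apply: eq_bigr => i /negbTE->.
Qed.

(** In the middle of an augmentation the entry of [w] may be stale, its old mate having just been
    relinked; the true matching has [w] free. This is the last step of the path, where [u] is
    free. *)
Lemma matched_link ml mr u w : u < n -> w \in nb u ->
  matched ml (upd mr w 0) -> ml u = 0 ->
  matched (upd ml u w.+1) (upd mr w u.+1).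
Proof.
move=> un wu [m1 m2 m3] mu; have wn := ls_lt wu; split.
- move=> x y xn yn; move: (m1 x y xn yn) (m1 u y un yn); rewrite /upd.
  by case: (eqVneq x u) => [->|xu]; case: (eqVneq y w) => [->|yw]; lia.
- move=> x y xn; rewrite /upd; case: eqVneq => [->[<-]//|_].
  exact: m2.
- move=> y x; rewrite /upd; case: eqVneq => [_ [<-]//|yw my].
  by apply: (m3 y); rewrite /upd (negbTE yw).
Qed.

(** An inner step of the path: [u] leaves [v] for [w], after which the entry of [v] is the stale
    one. *)
Lemma matched_swap ml mr u w v : u < n -> w \in nb u ->
  matched ml (upd mr w 0) -> ml u = v.+1 ->
  matched (upd ml u w.+1) (upd (upd mr w u.+1) v 0).
Proof.
move=> un wu [m1 m2 m3] mu; have wn := ls_lt wu.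
have vn := ls_lt (m2 _ _ un mu).
have mv : upd mr w 0 v = u.+1 by rewrite -m1.
have vw : v != w by apply: contra_eq_neq mv => ->; rewrite /upd eqxx.
split.
- move=> x y xn yn; move: (m1 x y xn yn) (m1 x v xn vn) mv.
  have := m1 u y un yn; rewrite /upd (negbTE vw).
  case: (eqVneq x u) => [->|xu]; case: (eqVneq y v) => [->|yv];
    case: (eqVneq y w) => [yw|yw]; rewrite ?(negbTE vw); lia.
- move=> x y xn; rewrite /upd; case: eqVneq => [->[<-]//|_].
  exact: m2.
- move=> y x; rewrite /upd; case: eqVneq => // _.
  case: eqVneq => [_ [<-]//|yw my].
  by apply: (m3 y); rewrite /upd (negbTE yw).
Qed.

Definition augment_cost := (n * (cmd_size augment_body).+1).+1.

(** In the second case, that no stable set existed before shows that a matching which has one is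
    never augmented again. *)
Lemma augment_spec s0 :
  stored s0 -> matched (arr s0 aL) (arr s0 aR) ->
  search_done (arr s0 aL) (arr s0 aR) s0 ->
  runs augment s0 augment_cost (fun s =>
    matched (arr s aL) (arr s aR) /\
    ((exists A, stable (arr s aL) (arr s aR) A) \/
     ~ (exists A, stable (arr s0 aL) (arr s0 aR) A) /\
     (free (arr s aL)).+1 = free (arr s0 aL))).
Proof.
move=> st0 M0 D; have SD := search_doneP D; case: D => [q].
move=> [[Qu Qlt Qt Qa Qi] [X1 X2 X3 X4]].
have z0 : reg s0 rZ = 0 by case: st0.
set ml0 := arr s0 aL in M0 SD X1 X2 *; set mr0 := arr s0 aR in M0 SD X2 X3 X4.
set d := (cmd_size augment_body).+1.
case E0 : (reg s0 rWF) => [|w0].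
  exists 1, s0; split=> //; first by apply: ExecWhileF; rewrite E0.
  by split=> //; left; apply/SD.
have szq : size q <= n.
  by rewrite -[n](size_iota 0); apply: uniq_leq_size => // x /Qlt; rewrite mem_iota.
(* The path is walked back through parents, so the queue position of [rFU] falls and bounds the
   remaining rounds. Left entries up to that position are still the original ones. *)
pose I T s := 
  (reg s rWF = 0 /\ matched (arr s aL) (arr s aR) /\
     (free (arr s aL)).+1 = free ml0) \/
  exists w, reg s rWF = w.+1 /\ [/\ reg s rFU \in q, w \in nb (reg s rFU),
    matched (arr s aL) (upd (arr s aR) w 0), free (arr s aL) = free ml0 &
    (index (reg s rFU) q).+1 * d <= T /\
    forall x, x \in q -> index x q <= index (reg s rFU) q -> arr s aL x = ml0 x].
have [f1 f2 f3] := X3 _ E0.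
have := @runs_while rZ rWF augment_body I ((index (reg s0 rFU) q).+1 * d) s0.
case=> [|T s fs [[-> //]|[w [wE [uq wu Mw Fw [TE same]]]]] _|t [s [e lt]]].
- right; exists w0; split=> //; split=> //.
  have [m1 m2 m3] := M0; split=> //.
  + move=> u w un wn; rewrite m1 // /upd; case: eqVneq => // ->.
    by rewrite f3.
  + by move=> w u; rewrite /upd; case: eqVneq => // _ /m3.
- set u := reg s rFU in uq wu TE same *; have un := Qlt _ uq.
  have [fr fa] := fs.
  have mu : arr s aL u = ml0 u by apply: same.
  exists (cmd_size augment_body), ((index u q) * d); split.
    by rewrite mulSn /d in TE *; lia.
  apply: runs_eval => //=; rewrite -/u wE /= mu.
  have fE := free_upd (arr s aL) w.+1 un.
  case Eu : (ml0 u) => [|v].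
    left; split=> //=; split; first exact: matched_link un wu Mw (etrans mu Eu).
    by move: fE; rewrite mu Eu Fw /=; rewrite /upd addn1 addn0.
  right; exists v; split=> //=.
  have [|[pt [v' vp mv]]] := X2 _ uq; first by rewrite Eu.
  have vn : v < n.
    have [_ m2 _] := M0; exact: ls_lt (m2 _ _ un Eu).
  (* The right vertex through which [u] was reached is its old mate [v], so the parent of [u] is
     adjacent to [v] and can be linked to it next. *)
  have vv : v' = v.
    have [m1 _ _] := M0; have v'n := ls_lt vp.
    by move/(m1 _ _ un v'n): mv; rewrite Eu => -[].
  rewrite (fa aPar) // -{1}vv; set p := arr s0 aPar u in pt vp *.
  have lt : index p q < index u q by apply: index_ltn.
  split=> //.
  + exact: mem_take pt.
  + exact: matched_swap un wu Mw (etrans mu Eu).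
  + by move: fE; rewrite mu Eu Fw /=; rewrite /upd !addn0.
  + split; first by rewrite leq_mul2r lt orbT.
    move=> x xq xp; case: eqVneq => [xu|_]; first by rewrite xu in xp; lia.
    by apply: same => //; lia.
- move=> [wF [T' [[w0E [M F]]|[w [wE _]]]]]; last first.
    by have [fr _] := exec_frame e; move: wF; rewrite wE fr // z0.
  exists t, s; split=> //; last first.
    by split=> //; right; split=> // /SD; rewrite E0.
  apply: leq_trans lt _; rewrite ltnS leq_mul2r; apply/orP; right.
  by apply: leq_trans szq; rewrite index_mem.
Qed.

Definition matching_cost := n * (search_cost + augment_cost).+2 + 2.

(** Each round either leaves a matching with a stable set or lowers the number of free left
    vertices, which is at most [n] at the start. *)
Lemma matching_spec s0 :
  stored s0 -> arr s0 aL =1 (fun _ => 0) -> arr s0 aR =1 (fun _ => 0) ->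
  runs matching s0 matching_cost (fun s =>
    matched (arr s aL) (arr s aR) /\
    exists A, stable (arr s aL) (arr s aR) A).
Proof.
move=> st0 l0 r0.
pose I k s := reg s rK = k /\ matched (arr s aL) (arr s aR) /\
  ((exists A, stable (arr s aL) (arr s aR) A) \/ free (arr s aL) + k <= n).
set s1 := set_reg s0 rK 0.
have I1 : I 0 s1.
  split=> //; split.
    by split=> /= [u w|u w|w u]; rewrite ?l0 ?r0.
  right; rewrite addn0 /free -[leqRHS](size_iota 0 n) -[leqRHS]sum1_size.
  by apply: leq_sum => i _; case: eqP.
suff: runs matching s0 (1 + (n * (search_cost + augment_cost + 1).+1).+1) (I n).
  move=> /runs_weaken; apply=> [|s _ [_ [M [?|F]]]].
  - by rewrite /matching_cost !addnS; lia.
  - by split.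
  (* After [n] successful augmentations no left vertex is free, so the empty set is stable. *)
  - split=> //; exists pred0; split=> // u un mu.
    have ui : u \in iota 0 n by rewrite mem_iota.
    by move: F; rewrite /free (bigD1_seq u ui (iota_uniq _ _)) /= mu; lia.
apply: runs_seq; apply: runs_eval => //=; rewrite -/s1.
have st1 : stored s1 by case: st0.
apply: runs_for => [//|k s kn [fr fa] [kE _]|k s kn fs [kE [M SF]]].
  by case: st1 => n1 _ _ _; rewrite kE fr // n1.
have st := stored_frame (isT : keeps_input matching_body) fs st1.
apply: runs_seq; apply: runs_seq.
have mr_lt w : 0 < arr s aR w -> (arr s aR w).-1 < n.
  by case: M => _ _ /(_ w); case: (arr s aR w) => // u /(_ u erefl).
apply: (runs_weaken (search_spec st mr_lt)) => // s2 f2 D.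
have st2 := stored_frame (isT : keeps_input search) f2 st.
have [fr2 fa2] := f2.
have := @augment_spec s2; rewrite !fa2 // => /(_ st2 M D) /runs_weaken.
apply=> // s3 f3 [M3 S3]; have [fr3 fa3] := f3.
apply: runs_eval => //; split=> /=; first by rewrite fr3 // fr2 // kE.
split=> //; case: S3 => [|[nst F3]]; first by left.
by case: SF => [//|F]; right; lia.
Qed.

(** * Selecting the vertices *)

(** Former mates keep their entries, so the result need not be a matching. It only makes the
    vertices of [S] sources on the left and forbidden targets on the right. *)
Definition clear (S : seq nat) (f : nat -> nat) : nat -> nat :=
  fun i => if i \in S then 0 else f i.

Lemma clear_cons v S f : clear (v :: S) f =1 upd (clear S f) v 0.
Proof. by move=> i; rewrite /clear /upd inE; case: eqP. Qed.

(** Clearing more entries only adds constraints; hence a vertex once rejected stays rejected as the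
    accepted set grows. *)
Lemma stable_clear_sub S S' ml mr A : {subset S <= S'} ->
  stable (clear S' ml) (clear S' mr) A -> stable (clear S ml) (clear S mr) A.
Proof.
move=> SS' [s1 s2]; split=> [u un mu|u w un Au wu].
  apply: s1 => //; move: mu; rewrite /clear.
  by case: ifP => [/SS'->//|_ ->]; case: ifP.
have := s2 u w un Au wu; rewrite /clear.
by case: (boolP (w \in S)) => [/SS'->//|_]; case: ifP => // _ [].
Qed.

Lemma test_spec s0 v : stored s0 -> reg s0 rV = v ->
  (forall w, 0 < arr s0 aR w -> (arr s0 aR w).-1 < n) ->
  runs test s0 (4 + search_cost) (fun s =>
    [/\ reg s rS1 = arr s0 aL v, reg s rS2 = arr s0 aR v,
        arr s aL =1 upd (arr s0 aL) v 0, arr s aR =1 upd (arr s0 aR) v 0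
      & reg s rWF = 0 <->
        exists A, stable (upd (arr s0 aL) v 0) (upd (arr s0 aR) v 0) A]).
Proof.
move=> st0 vE mr_lt; have z0 : reg s0 rZ = 0 by case: st0.
apply: runs_seq; apply: runs_eval => //=; rewrite vE z0.
set s1 := set_arr _ _ _ _.
have st1 : stored s1 by case: st0.
apply: runs_weaken (search_spec st1 _) _ _ => //.
  by move=> w /=; case: eqP => // _; apply: mr_lt.
move=> s f D; have [fr fa] := f.
by split; [rewrite fr | rewrite fr | rewrite fa | rewrite fa | exact (search_doneP D)].
Qed.

(** The 20 covers 4 instructions of [test] before its search and at most 16 of [decide]. *)
Definition select_cost := 20 + search_cost.

Lemma select_step_spec b s0 v : stored s0 -> reg s0 rV = v ->
  (forall w, 0 < arr s0 aR w -> (arr s0 aR w).-1 < n) ->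
  let st := exists A, stable (upd (arr s0 aL) v 0) (upd (arr s0 aR) v 0) A in
  runs (test;; decide b) s0 select_cost (fun s =>
    reg s rK = (reg s0 rK).+1 /\
    if reg s rWF == 0 then
      [/\ st, arr s aOut =1 upd (arr s0 aOut) v 1,
          arr s aL =1 (if b then arr s0 aL else upd (arr s0 aL) v 0) &
          arr s aR =1 (if b then arr s0 aR else upd (arr s0 aR) v 0)]
    else
      [/\ ~ st, arr s aOut =1 arr s0 aOut,
          arr s aL =1 arr s0 aL & arr s aR =1 arr s0 aR]).
Proof.
move=> st0 vE mr_lt st.
have lf : loop_free (decide b) by case: b.
have ds : cmd_size (decide b) <= 16 by case: (b).
apply: (runs_weaken (T := 4 + search_cost + cmd_size (decide b))
  _ _ (fun _ _ H => H)).
  apply: runs_seq; apply: runs_weaken (test_spec st0 vE mr_lt) (leqnn _) _.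
  move=> s f [e1 e2 el er ew]; have [fr fa] := f.
  have z : reg s rZ = 0 by rewrite fr //; case: st0.
  have vE' : reg s rV = v by rewrite fr.
  apply: runs_eval => //=; rewrite z.
  have updK g : upd (upd g v 0) v (g v) =1 g.
    by move=> i; rewrite /upd; case: eqP => [->|].
  case: ltnP => wF /=.
    rewrite fr // gtn_eqF //; split=> //.
    split=> [/ew| | i | i] /=; first by lia.
    - by rewrite fa.
    - by rewrite vE' e1 el -[RHS]updK /upd; case: eqP.
    - by rewrite vE' e2 er -[RHS]updK /upd; case: eqP.
  have {}wF : reg s rWF = 0 by lia.
  case: b {lf ds} => /=; rewrite fr // wF; split=> //.
    split=> [|i|i|i] /=; first exact/ew.
    - by rewrite vE' fa.
    - by rewrite vE' e1 el -[RHS]updK /upd; case: eqP.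
    - by rewrite vE' e2 er -[RHS]updK /upd; case: eqP.
  by split=> [|i|//|//] /=; [apply/ew | rewrite vE' fa].
by rewrite /select_cost; lia.
Qed.

(** Every test is undone, so all tests see the same matching and their outcomes do not depend on the
    order. *)
Lemma select_listed_spec vs s0 : stored s0 ->
  (forall w, 0 < arr s0 aR w -> (arr s0 aR w).-1 < n) ->
  reg s0 rLen = size vs ->
  (forall i, i < size vs -> arr s0 aAux i = nth 0 vs i) ->
  arr s0 aOut =1 (fun _ => 0) ->
  runs (select true) s0 (size vs * select_cost.+2 + 2) (fun s =>
    exists S : seq nat, (forall x, arr s aOut x = (x \in S)) /\
      forall x, x \in S <-> x \in vs /\
        exists A, stable (upd (arr s0 aL) x 0) (upd (arr s0 aR) x 0) A).
Proof.
move=> st0 mr_lt lenE auxE out0.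
set ml := arr s0 aL; set mr := arr s0 aR in mr_lt *.
pose I k s := [/\ reg s rK = k, arr s aL =1 ml, arr s aR =1 mr &
  exists S : seq nat, (forall x, arr s aOut x = (x \in S)) /\
      forall x, x \in S <-> x \in take k vs /\
        exists A, stable (upd ml x 0) (upd mr x 0) A].
suff: runs (select true) s0 (1 + (size vs * (1 + select_cost).+1).+1)
    (I (size vs)).
  move=> /runs_weaken; apply=> [|s _ [_ _ _]]; first by rewrite !add1n addn2.
  by rewrite take_size.
apply: runs_seq; apply: runs_eval => //=.
set s1 := set_reg s0 rK 0.
have st1 : stored s1 by case: st0.
apply: runs_for => [|k s kn [fr fa] [kE _ _ _]|k s kn fs [kE lE rE [S [SE SP]]]].
- split=> //; exists [::]; split=> // x; split=> //.
  by rewrite take0 => -[].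
- by rewrite kE fr //= lenE.
have st := stored_frame (isT : keeps_input (select_body true)) fs st1.
have [fr fa] := fs; set v := nth 0 vs k.
apply: runs_seq; apply: runs_eval => //=.
have vE : arr s aAux (reg s rK) = v by rewrite fa //= kE auxE.
rewrite vE; set s2 := set_reg s rV v.
have st2 : stored s2 by case: st.
have mr_lt2 w : 0 < arr s2 aR w -> (arr s2 aR w).-1 < n.
  by rewrite /= rE; apply: mr_lt.
have stE : (exists A, stable (upd (arr s2 aL) v 0) (upd (arr s2 aR) v 0) A) <->
    (exists A, stable (upd ml v 0) (upd mr v 0) A).
  by split=> -[A sA]; exists A; apply: stable_eq sA => i;
     rewrite /upd /= ?lE ?rE.
apply: runs_weaken (select_step_spec true st2 erefl mr_lt2) (leqnn _) _.
move=> s' _ [kE']; rewrite /I (take_nth 0) // -/v; case: eqP => _.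
  move=> [/stE sv oE lE' rE']; split.
  - by rewrite kE' /= kE.
  - by move=> i; rewrite lE' /= lE.
  - by move=> i; rewrite rE' /= rE.
  exists (v :: S); split=> [x|x].
    by rewrite oE /upd /= inE SE; case: eqP.
  rewrite inE mem_rcons inE; case: eqVneq => [->|_] //=; exact: SP.
move=> [nst oE lE' rE']; split.
- by rewrite kE' /= kE.
- by move=> i; rewrite lE' /= lE.
- by move=> i; rewrite rE' /= rE.
exists S; split=> [x|x]; first by rewrite oE /= SE.
rewrite mem_rcons inE; case: eqVneq => [->|_] //=.
by split=> [/SP[]//|[_ /stE/nst]].
Qed.

(** Cleared entries accumulate. A rejection concerns the set [S] of its time and is carried to the
    final [S] by [stable_clear_sub]. *)
Lemma select_greedy_spec s0 : stored s0 ->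
  (forall w, 0 < arr s0 aR w -> (arr s0 aR w).-1 < n) ->
  (exists A, stable (arr s0 aL) (arr s0 aR) A) ->
  arr s0 aOut =1 (fun _ => 0) ->
  let st S := exists A, stable (clear S (arr s0 aL)) (clear S (arr s0 aR)) A in
  runs (select false) s0 (n * select_cost.+2 + 2) (fun s =>
    exists S : seq nat, [/\ forall x, arr s aOut x = (x \in S),
      forall x, x \in S -> x < n, st S
    & forall x, x < n -> x \notin S -> ~ st (x :: S)]).
Proof.
move=> st0 mr_lt ex0 out0 stb.
pose ml := arr s0 aL; pose mr := arr s0 aR.
pose I k s := reg s rK = k /\
  exists S : seq nat, [/\ arr s aL =1 clear S ml, arr s aR =1 clear S mr,
    forall x, arr s aOut x = (x \in S),
    (forall x, x \in S -> x < k) /\ stb S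
  & forall x, x < k -> x \notin S -> ~ stb (x :: S)].
suff: runs (select false) s0 (1 + (n * (1 + select_cost).+1).+1) (I n).
  move=> /runs_weaken; apply=> [|s _]; first by rewrite !add1n addn2.
  by move=> [_ [S [_ _ SE [Slt sS] SP]]]; exists S.
apply: runs_seq; apply: runs_eval => //=.
set s1 := set_reg s0 rK 0.
have st1 : stored s1 by case: st0.
apply: runs_for => [|k s kn [fr fa] [kE _]|k s kn fs].
- by split=> //; exists [::].
- by rewrite kE fr //=; case: st0 => ->.
move=> [kE [S [lE rE SE [Slt sS] SP]]].
have st := stored_frame (isT : keeps_input (select_body false)) fs st1.
have [fr fa] := fs.
apply: runs_seq; apply: runs_eval => //=.
rewrite kE; set s2 := set_reg s rV k.
have st2 : stored s2 by case: st.
have mr_lt2 w : 0 < arr s2 aR w -> (arr s2 aR w).-1 < n.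
  by rewrite /= rE /clear; case: ifP => // _; apply: mr_lt.
have stE : (exists A, stable (upd (arr s2 aL) k 0) (upd (arr s2 aR) k 0) A) <->
    stb (k :: S).
  by split=> -[A sA]; exists A; apply: stable_eq sA => i;
     rewrite clear_cons /upd /= ?lE ?rE.
have sub x : stb [:: x, k & S] -> stb (x :: S).
  move=> [A sA]; exists A; apply: stable_clear_sub sA => y.
  by rewrite !inE => /orP[->|->]; rewrite ?orbT.
apply: runs_weaken (select_step_spec false st2 erefl mr_lt2) (leqnn _) _.
move=> s' _ [kE']; case: eqP => _.
  move=> [/stE sv oE lE' rE']; split; first by rewrite kE' /= kE.
  exists (k :: S); split.
  - by move=> i; rewrite lE' clear_cons /upd /= lE.
  - by move=> i; rewrite rE' clear_cons /upd /= rE.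
  - by move=> x; rewrite oE /upd /= inE SE; case: eqP.
  - split=> // x; rewrite inE => /orP[/eqP->//|/Slt]; exact: ltnW.
  - move=> x; rewrite inE ltnS leq_eqVlt.
    case: eqVneq => [->|_] //= xk xS /sub; exact: SP.
move=> [nst oE lE' rE']; split; first by rewrite kE' /= kE.
exists S; split.
- by move=> i; rewrite lE' /= lE.
- by move=> i; rewrite rE' /= rE.
- by move=> x; rewrite oE /= SE.
- split=> // x /Slt; exact: ltnW.
- move=> x; rewrite ltnS leq_eqVlt; case: eqVneq => [->|_] //=; last exact: SP.
  by move=> _ _ /stE/nst.
Qed.

End Search.

(** * Critical sets *)

Section Critical.
Variable G : sgraph.
Implicit Types (u v w : G) (S X Y Z I K : {set G}).

Lemma nbhsP X w : reflect (exists2 u, u \in X & adj u w) (w \in nbhs X).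
Proof.
apply: (iffP bigcupP) => -[u uX]; first by rewrite inE; exists u.
by exists u; rewrite ?inE.
Qed.

Lemma nbhsU X Y : nbhs (X :|: Y) = nbhs X :|: nbhs Y.
Proof. exact: bigcup_setU. Qed.

Lemma nbhs_sub X Y : X \subset Y -> nbhs X \subset nbhs Y.
Proof.
move=> XY; apply/subsetP => w /nbhsP[u uX uw].
by apply/nbhsP; exists u; rewrite ?(subsetP XY).
Qed.

Lemma independentP I :
  reflect {in I &, forall x y, ~~ adj x y} (independent I).
Proof.
apply: (iffP forall_inP) => [h x y xI yI|h x xI].
  by move: (h x xI) => /forall_inP/(_ y yI).
by apply/forall_inP => y yI; apply: h.
Qed.

Lemma independent_nbhs I v : independent I -> v \in I -> v \notin nbhs I.
Proof.
move=> /independentP iI vI; apply/nbhsP => -[u uI uv].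
by have := iI _ _ uI vI; rewrite uv.
Qed.

(* [diff Y <= diff X] for all [Y], without subtraction. *)
Definition critical X : Prop :=
  forall Y, #|Y| + #|nbhs X| <= #|X| + #|nbhs Y|.

Lemma diff_le X Y :
  (diff Y <= diff X)%R = (#|Y| + #|nbhs X| <= #|X| + #|nbhs Y|).
Proof. by rewrite /diff; lia. Qed.

(** Submodularity of the neighbourhood size; it makes the critical sets a lattice. *)
Lemma card_nbhsUI X Y :
  #|nbhs (X :|: Y)| + #|nbhs (X :&: Y)| <= #|nbhs X| + #|nbhs Y|.
Proof.
rewrite nbhsU -[leqRHS]cardsUI leq_add2l subset_leq_card // subsetI.
by rewrite !nbhs_sub ?subsetIl ?subsetIr.
Qed.

Lemma criticalU X Y : critical X -> critical Y -> critical (X :|: Y).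
Proof.
move=> cX cY Z; move: (cX Z) (cY (X :&: Y)) (cardsUI X Y) (card_nbhsUI X Y).
by lia.
Qed.

Lemma criticalI X Y : critical X -> critical Y -> critical (X :&: Y).
Proof.
move=> cX cY Z; move: (cX Z) (cY (X :|: Y)) (cardsUI X Y) (card_nbhsUI X Y).
by lia.
Qed.

Lemma core_independent X : independent (X :\: nbhs X).
Proof.
apply/independentP => x y; rewrite !inE => /andP[_ xX] /andP[yN _].
by apply: contra yN => xy; apply/nbhsP; exists x.
Qed.

(** No neighbour of the core lies in [X], so passing to the core removes [X :&: nbhs X] from [X] and
    at least as much from the neighbourhood. *)
Lemma core_diff X :
  #|X| + #|nbhs (X :\: nbhs X)| <= #|X :\: nbhs X| + #|nbhs X|.
Proof.
have: #|nbhs (X :\: nbhs X)| <= #|nbhs X :\: X|.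
  apply/subset_leq_card/subsetP => w /nbhsP[u]; rewrite !inE.
  move=> /andP[uN uX] uw; apply/andP; split; last by apply/nbhsP; exists u.
  by apply: contra uN => wX; apply/nbhsP; exists w; rewrite // adj_sym.
move: (cardsID (nbhs X) X) (cardsID X (nbhs X)).
by rewrite (setIC (nbhs X)); lia.
Qed.

Lemma critical_core X : critical X -> critical (X :\: nbhs X).
Proof. by move=> cX Y; move: (cX Y) (core_diff X); lia. Qed.

(** [critical_independent] compares with independent sets only; an arbitrary set is replaced by its
    core, which does at least as well. *)
Lemma critical_independentP I :
  critical_independent I <-> independent I /\ critical I.
Proof.
split=> -[iI cI]; split=> // Y; last by rewrite diff_le.
by have := cI _ (core_independent Y); rewrite diff_le; move: (core_diff Y); lia.
Qed.

(* The max independent set [X, ~: nbhs X] of the bi-double graph, read with the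
   two sides exchanged. *)
Lemma critical_compl X : critical X -> critical (~: nbhs X).
Proof.
move=> cX Y.
have: #|nbhs (~: nbhs X)| <= #|~: X|.
  apply/subset_leq_card/subsetP => w /nbhsP[u]; rewrite !inE => uN uw.
  by apply: contra uN => wX; apply/nbhsP; exists w; rewrite // adj_sym.
by move: (cX Y) (cardsC X) (cardsC (nbhs X)); lia.
Qed.

Lemma critical_extend I K :
  independent I -> critical I -> independent K -> critical K ->
  independent (I :|: (K :\: nbhs I)) /\ critical (I :|: (K :\: nbhs I)).
Proof.
move=> iI cI iK cK; split; last first.
  rewrite setDE; apply: criticalU => //.
  by apply: criticalI => //; apply: critical_compl.
have nI x y : x \in I -> y \in K :\: nbhs I -> ~~ adj x y.
  by move=> xI; rewrite inE => /andP[yN _]; apply: contra yN => xy;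
     apply/nbhsP; exists x.
apply/independentP => x y; rewrite !(in_setU x, in_setU y).
move=> /orP[xI|xK] /orP[yI|yK].
- by move/independentP: iI; apply.
- exact: nI.
- by rewrite adj_sym; apply: nI.
- move: xK yK; rewrite !inE => /andP[_ xK] /andP[_ yK].
  by move/independentP: iK; apply.
Qed.

(** Equivalently, the maximum independent set of the bi-double graph given by [X] contains both
    copies of every vertex of [S]. *)
Definition extends S X : Prop :=
  critical X /\ forall v, v \in S -> v \in X /\ v \notin nbhs X.

Lemma extends_core S X : extends S X ->
  S \subset X :\: nbhs X /\ critical (X :\: nbhs X).
Proof.
move=> [cX SX]; split; last exact: critical_core.
by apply/subsetP => v /SX[vX vN]; rewrite inE vN.
Qed.

Lemma extends_independent S I :
  independent I -> critical I -> S \subset I -> extends S I.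
Proof.
move=> iI cI SI; split=> // v /(subsetP SI) vI; split=> //.
exact: independent_nbhs.
Qed.

Lemma greedy_max_critical I :
  (exists X, extends I X) ->
  (forall v, v \notin I -> ~ exists X, extends (v |: I) X) ->
  max_critical_independent I.
Proof.
move=> [X /extends_core[IX cX]] mI.
have maxI J : independent J -> critical J -> I \subset J -> J \subset I.
  move=> iJ cJ IJ; apply/subsetP => v vJ; apply: contraT => /mI[].
  by exists J; apply: extends_independent; rewrite // subUset sub1set vJ.
(* The core of [X] is a critical independent set containing [I], so maximality forces equality. *)
have IE : I = X :\: nbhs X.
  by apply/eqP; rewrite eqEsubset IX maxI ?core_independent.
have iI : independent I by rewrite IE core_independent.
have cI : critical I by rewrite IE.
split=> [|K]; first by apply/critical_independentP.
move=> /critical_independentP[iK cK].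
have [iL cL] := critical_extend iI cI iK cK.
have KI : K :\: nbhs I \subset I.
  by apply: subset_trans (maxI _ iL cL (subsetUl _ _)); apply: subsetUr.
(* Criticality of [I] against [I :\: nbhs P] is Hall's condition for matching
   [P] into [I :\: K]. *)
pose P := K :&: nbhs I; pose Z := I :\: nbhs P.
have NZ : #|nbhs Z| + #|P| <= #|nbhs I|.
  rewrite -cardsUI (_ : nbhs Z :&: P = set0) ?cards0 ?addn0.
    by rewrite subset_leq_card // subUset subsetIr nbhs_sub // subsetDl.
  apply/setP => w; rewrite in_set0 in_setI; apply/negbTE/negP.
  move=> /andP[/nbhsP[z]]; rewrite in_setD => /andP[zN _] zw wP.
  by case/negP: zN; apply/nbhsP; exists w; rewrite // adj_sym.
have IP : #|I :&: nbhs P| <= #|I :\: K|.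
  apply/subset_leq_card/subsetP => x; rewrite !in_setI in_setD.
  move=> /andP[-> /nbhsP[p]]; rewrite in_setI => /andP[pK _] px.
  by rewrite andbT; apply/negP => xK; move/independentP: iK => /(_ p x pK xK);
     rewrite px.
have IK : #|K :\: nbhs I| <= #|I :&: K|.
  by rewrite subset_leq_card // subsetI KI subsetDl.
(* [cI Z] and [NZ] give |P| <= |I| - |Z| = |I :&: nbhs P| <= |I :\: K|; adding [IK] yields |K| <=
   |I|. *)
move: (cI Z) (cardsID (nbhs P) I) (cardsID K I) (cardsID (nbhs I) K).
by rewrite -/P -/Z; lia.
Qed.

End Critical.

(** * Larson's test *)

Section LarsonTest.
Variable G : sgraph.
Local Notation B := (bidouble G).
Implicit Types (v : G) (X : {set G}) (S : {set B}).

Lemma alpha_ge (H : sgraph) (I : {set H}) : independent I -> #|I| <= alpha H.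
Proof. by move=> iI; apply: leq_bigmax_cond. Qed.

Lemma alpha_attained (H : sgraph) : exists2 I : {set H}, independent I & #|I| = alpha H.
Proof.
have [I iI ->] : {I : {set H} | independent I & alpha H = #|I|}.
  apply: eq_bigmax_cond; apply/card_gt0P; exists set0.
  by rewrite unfold_in; apply/independentP => x; rewrite inE.
by exists I.
Qed.

Definition left_part S : {set G} := [set u | inl u \in S].
Definition right_part S : {set G} := [set u | inr u \in S].

Lemma card_bidouble S : #|S| = #|left_part S| + #|right_part S|.
Proof.
rewrite -!sum1_card big_mkcond big_sumType /= -!big_mkcond.
by congr (_ + _); apply: eq_bigl => u; rewrite inE.
Qed.

Lemma bidouble_independent_right S :
  independent S -> right_part S \subset ~: nbhs (left_part S).
Proof.
move=> /independentP iS; apply/subsetP => w; rewrite !inE => wS.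
apply/nbhsP => -[u]; rewrite inE => uS uw.
by have := iS _ _ uS wS; rewrite /= uw.
Qed.

(** The right part avoids the neighbours of the left part. As [bidouble_set] attains the bound,
    [alpha B] is n plus the maximum of |X| - |N(X)|, and maximum independent sets have critical left
    parts. *)
Lemma bidouble_independent_card S :
  independent S -> #|S| + #|nbhs (left_part S)| <= #|left_part S| + #|G|.
Proof.
move=> /bidouble_independent_right/subset_leq_card.
by move: (cardsC (nbhs (left_part S))); rewrite card_bidouble; lia.
Qed.

Definition bidouble_set X : {set B} :=
  [set a | match a with inl u => u \in X | inr w => w \notin nbhs X end].

Lemma bidouble_set_independent X : independent (bidouble_set X).
Proof.
apply/independentP => -[x|x] [y|y] //=; rewrite !inE => hx hy; last first.
  by apply: contra hx => yx; apply/nbhsP; exists y.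
by apply: contra hy => xy; apply/nbhsP; exists x.
Qed.

Lemma bidouble_set_card X : #|bidouble_set X| + #|nbhs X| = #|X| + #|G|.
Proof.
rewrite card_bidouble -(cardsC (nbhs X)) addnA addnAC -!addnA.
congr (_ + _); first by apply: eq_card => u; rewrite !inE.
by congr (_ + _); apply: eq_card => u; rewrite !inE.
Qed.

Lemma in_bidouble_del v (a : B) :
  a \in ~: @cnbhs B [set inl v; inr v] =
  [&& a != inl v, a != inr v & ~~ adj (inl v : B) a && ~~ adj (inr v : B) a].
Proof.
rewrite in_setC /cnbhs in_setU negb_or /nbhs.
rewrite bigcup_setU !big_set1 in_setU !inE !negb_or.
by case: (a != inl v) (a != inr v) => -[]; rewrite ?andbF ?andbT.
Qed.

(** Adding both copies of [v] to an independent set of [bidouble_del v] keeps it independent, so the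
    test asks whether some maximum independent set contains both copies. Its left part is then
    critical; conversely a critical [X] gives the maximum set [bidouble_set X]. *)
Lemma larson_testP v :
  reflect (exists X, extends [set v] X) (larson_test v).
Proof.
pose v2 : {set B} := [set inl v; inr v].
have adjl (a : B) : a \in v2 -> adj a (inl v : B) = false.
  by rewrite !inE => /orP[]/eqP-> //=; rewrite adj_irr.
have adjr (a : B) : a \in v2 -> adj a (inr v : B) = false.
  by rewrite !inE => /orP[]/eqP-> //=; rewrite adj_irr.
have adj2 (a b : B) : a \in v2 -> b \in v2 -> ~~ adj a b.
  by move=> av; rewrite !inE => /orP[]/eqP->; rewrite ?adjl ?adjr.
have addv (J : {set bidouble_del v}) : independent J ->
    independent (v2 :|: [set val x | x in J]) /\
    #|v2 :|: [set val x | x in J]| = #|J| + 2.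
  move=> /independentP iJ.
  have nv (a b : B) : a \in v2 -> b \in [set val x | x in J] -> ~~ adj a b.
    move=> av /imsetP[x _ ->]; have := valP x.
    rewrite in_bidouble_del => /and4P[_ _ h1 h2].
    by move: av; rewrite !inE => /orP[]/eqP->.
  split.
    apply/independentP => a b; rewrite (in_setU a) (in_setU b) => /orP[av|aJ] /orP[bv|bJ].
    - exact: adj2.
    - exact: nv.
    - by rewrite adj_sym; apply: nv.
    - by case/imsetP: aJ bJ => x xJ -> /imsetP[y yJ ->]; apply: iJ.
  rewrite cardsU card_imset; last exact: val_inj.
  rewrite cards2 (_ : v2 :&: _ = set0) ?cards0 ?subn0 1?addnC //.
  apply/setP => a; rewrite in_set0 in_setI; apply/negbTE/negP.
  move=> /andP[av /imsetP[x _ aE]]; have := valP x; rewrite -aE in_bidouble_del.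
  by move: av; rewrite !inE => /orP[]/eqP->; rewrite eqxx ?andbF.
have le : alpha (bidouble_del v) + 2 <= alpha B.
  have [J iJ <-] := alpha_attained (bidouble_del v).
  by have [i2 <-] := addv _ iJ; apply: alpha_ge.
apply: (iffP eqP) => [E|[X [cX vX]]].
  have [J iJ JE] := alpha_attained (bidouble_del v).
  have [iS SE] := addv _ iJ; move: iS SE; set S := _ :|: _ => iS SE.
  have lS : inl v \in S by rewrite !inE eqxx.
  have rS : inr v \in S by rewrite !inE eqxx orbT.
  exists (left_part S); split.
    move=> Y; have := alpha_ge (bidouble_set_independent Y).
    rewrite E -JE -SE.
    by move: (bidouble_set_card Y) (bidouble_independent_card iS); lia.
  move=> u /set1P->; split; first by rewrite inE.
  have vr : v \in right_part S by rewrite inE.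
  by have := subsetP (bidouble_independent_right iS) v vr; rewrite in_setC.
have [{}vX vN] := vX v (set11 v).
apply/eqP; rewrite eqn_leq le andbT.
have [S iS SE] := alpha_attained B.
pose S' := bidouble_set X; have iS' := bidouble_set_independent X.
have SS' : alpha B <= #|S'|.
  rewrite -SE; move: (bidouble_independent_card iS) (cX (left_part S)).
  by move: (bidouble_set_card X); rewrite -/S'; lia.
pose J : {set bidouble_del v} := [set x | val x \in S'].
have iJ : independent J.
  apply/independentP => x y; rewrite !inE => xS yS.
  by move/independentP: iS'; apply; rewrite inE.
have JS : S' \subset v2 :|: [set val x | x in J].
  apply/subsetP => a aS; rewrite in_setU.
  case: (boolP (a \in v2)) => //= av.
  have aD : a \in ~: @cnbhs B [set inl v; inr v].
    have lS : inl v \in S' by rewrite inE.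
    have rS : inr v \in S' by rewrite inE.
    rewrite in_bidouble_del (independentP _ iS' _ _ lS aS).
    rewrite (independentP _ iS' _ _ rS aS).
    by move: av; rewrite in_set2 negb_or => /andP[-> ->].
  by apply/imsetP; exists (exist _ a aD); rewrite // in_set.
apply: leq_trans SS' (leq_trans (subset_leq_card JS) _).
by have [_ ->] := addv _ iJ; rewrite leq_add2r alpha_ge.
Qed.

End LarsonTest.

(** * Runs of Larson's algorithm *)

Section LarsonRun.
Variable G : sgraph.
Implicit Types (v : G) (I J R : {set G}) (l picks : seq G).

(** The test ignores the state of the loop, so the picks determine the result; each round removes at
    least the vertex picked. *)
Lemma larson_loop_result I R picks J : larson_loop I R picks J ->
  J = I :|: [set v in picks | larson_test v] /\ size picks <= #|R|.
Proof.
elim=> {I R picks J} [I|I R v picks J vR tv _ [-> le]|I R v picks J vR tv _ [-> le]].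
- by split=> //; apply/setP => x; rewrite !inE orbF.
- split.
    apply/setP => x; rewrite !inE; case: (eqVneq x v) => [->|_] //=.
    by rewrite tv /= orbT.
  apply: (leq_ltn_trans le); apply/proper_card.
  rewrite properE subsetDl; apply/subsetPn; exists v => //.
  by rewrite !inE eqxx.
- split; last by rewrite (cardsD1 v) vR.
  apply/setP => x; rewrite !inE; case: (eqVneq x v) => [->|_] //=.
  by rewrite (negbTE tv) !andbF.
Qed.

(** Accepting a vertex discards only its closed neighbourhood, so the other members of an
    independent list remain available. *)
Lemma larson_loop_accept l picks I R J :
  uniq l -> {in l, forall v, v \in R /\ larson_test v} ->
  {in l &, forall u v, ~~ adj u v} ->
  larson_loop (I :|: [set v in l]) (R :\: cnbhs [set v in l]) picks J ->
  larson_loop I R (l ++ picks) J.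
Proof.
elim: l I R => [|v l IH] I R /=.
  move=> _ _ _; rewrite (_ : [set v in [::]] = set0); last by apply/setP => x; rewrite !inE.
  by rewrite /cnbhs /nbhs big_set0 !setU0 setD0.
move=> /andP[vl ul] lR ind loop.
have [vR tv] := lR v (mem_head _ _).
apply: LarsonAccept => //; apply: IH => //.
- move=> w wl; have wl' : w \in v :: l by rewrite inE wl orbT.
  have [wR tw] := lR w wl'; split=> //.
  rewrite !inE wR andbT negb_or ind ?mem_head // andbT.
  by apply: contraNneq vl => <-.
- by move=> x y xl yl; apply: ind; rewrite inE ?xl ?yl orbT.
have E1 : [set x in v :: l] = v |: [set x in l] by apply/setP => x; rewrite !inE.
have -> : (v |: I) :|: [set x in l] = I :|: [set x in v :: l].
  by rewrite E1 setUA (setUC I).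
have -> // : (R :\: cnbh v) :\: cnbhs [set x in l] = R :\: cnbhs [set x in v :: l].
rewrite setDDl; congr (_ :\: _).
by rewrite /cnbhs E1 nbhsU {2}/nbhs big_set1 /cnbh (setUC [set v] (nbh v)) setUACA.
Qed.

Lemma larson_loop_reject I R :
  {in R, forall v, ~~ larson_test v} -> exists picks, larson_loop I R picks I.
Proof.
have [k] := ubnP #|R|; elim: k R => // k IH R lt nt.
have [->|[v vR]] := set_0Vmem R; first by exists [::]; constructor.
have [|w|p lp] := IH (R :\ v); first by move: lt; rewrite (cardsD1 v) vR.
  by rewrite inE => /andP[_ /nt].
by exists (v :: p); apply: LarsonReject => //; apply: nt.
Qed.

(** Once [I] has been picked, a vertex outside its closed neighbourhood that passed the test would
    lie in a critical core, and [critical_extend] would enlarge [I]. So all remaining picks are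
    rejected. *)
Lemma larson_run_max_critical I :
  max_critical_independent I -> exists picks, larson_run picks I.
Proof.
move=> [/critical_independentP[iI cI] mI].
have [p lp] : exists p, larson_loop I (~: cnbhs I) p I.
  apply: larson_loop_reject => v; rewrite in_setC in_setU negb_or.
  move=> /andP[vN vI]; apply/larson_testP => -[X /extends_core].
  rewrite sub1set => -[vX cX].
  have [iL cL] := critical_extend iI cI (core_independent X) cX.
  have /mI : critical_independent (I :|: ((X :\: nbhs X) :\: nbhs I)).
    by apply/critical_independentP.
  apply/negP; rewrite -ltnNge; apply: proper_card.
  rewrite properE subsetUl; apply/subsetPn; exists v => //.
  by rewrite in_setU [v \in _ :\: nbhs I]in_setD vN vX orbT.
have eI : [set v in enum I] = I by apply/setP => v; rewrite inE mem_enum.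
exists (enum I ++ p); apply: larson_loop_accept; rewrite ?enum_uniq //.
- move=> v; rewrite mem_enum inE => vI; split=> //; apply/larson_testP.
  by exists I; apply: extends_independent; rewrite ?sub1set.
- by move=> x y; rewrite !mem_enum; apply/independentP.
- by rewrite eI set0U setTD.
Qed.

End LarsonRun.

(** * Counting edges *)

Section Counting.
Variable G : sgraph.

Lemma edge_in_edges (x y : G) : adj x y -> [set x; y] \in edges G.
Proof.
by move=> xy; rewrite inE; apply/existsP; exists x; apply/existsP; exists y;
   rewrite xy /=.
Qed.

Lemma edge_card (e : {set G}) : e \in edges G -> #|e| <= 2.
Proof.
rewrite inE => /existsP[x /existsP[y /andP[_ /eqP->]]].
by rewrite cards2; case: eqP.
Qed.

(** With an edge present, connectedness excludes isolated vertices, so the edges cover all vertices,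
    at most two each. *)
Lemma connected_card_le : connected G -> 0 < #|edges G| ->
  #|G| <= 2 * #|edges G|.
Proof.
move=> conn /card_gt0P[e]; rewrite inE => /existsP[a /existsP[b /andP[ab _]]].
have deg (x : G) : exists y, adj x y.
  have [->|xa] := eqVneq x a; first by exists b.
  have /connectP[[|y p] /=] := conn x a; first by move=> _ aE; rewrite aE eqxx in xa.
  by move=> /andP[xy _] _; exists y.
rewrite -cardsT; apply: (@leq_trans #|\bigcup_(e in edges G) e|).
  apply/subset_leq_card/subsetP => x _; have [y xy] := deg x.
  by apply/bigcupP; exists [set x; y]; rewrite ?edge_in_edges // in_set2 eqxx.
apply: leq_trans (leq_card_cover (edges G)) _.
rewrite mulnC -sum_nat_const; apply: leq_sum => e'; exact: edge_card.
Qed.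

(** Adjacent ordered pairs are covered by the squares of the edges, each of at most 4 elements;
    hence 4 instead of the exact 2. *)
Lemma sum_degrees_le : \sum_(v : G) #|nbh v| <= 4 * #|edges G|.
Proof.
have -> : \sum_(v : G) #|nbh v| = #|[set p : G * G | adj p.1 p.2]|.
  rewrite -sum1_card (eq_bigl (fun p => xpredT p.1 && adj p.1 p.2)); last first.
    by move=> p; rewrite inE.
  rewrite -(pair_big_dep xpredT (fun x y => adj x y) (fun _ _ => 1)) /=.
  by apply: eq_bigr => v _; rewrite -sum1_card; apply: eq_bigl => w; rewrite inE.
apply: (@leq_trans #|\bigcup_(e in edges G) setX e e|).
  apply/subset_leq_card/subsetP => -[x y]; rewrite inE /= => xy.
  apply/bigcupP; exists [set x; y]; first exact: edge_in_edges.
  by rewrite !inE !eqxx orbT.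
apply: (@leq_trans (\sum_(e in edges G) #|setX e e|)).
  elim/big_rec2: _ => [|e k A _ IH]; first by rewrite cards0.
  by apply: leq_trans (leq_card_setU _ _) _; rewrite leq_add2l.
rewrite mulnC -sum_nat_const; apply: leq_sum => e /edge_card e2.
by rewrite cardsX (leq_mul e2 e2).
Qed.

End Counting.

(** * Reading the memory as a graph *)

Section Transfer.
Variables (G : sgraph) (lab : G -> nat) (ls : seq (seq nat)).
Hypotheses (num : numbering lab) (adjl : adjacency_lists lab ls).

Lemma perm_lab : perm_eq [seq lab v | v <- enum G] (iota 0 (size ls)).
Proof.
have [inj lt] := num; have [sz _] := adjl.
have U : uniq [seq lab v | v <- enum G] by rewrite map_inj_uniq ?enum_uniq.
apply: uniq_perm; rewrite ?iota_uniq //.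
have sub : {subset [seq lab v | v <- enum G] <= iota 0 (size ls)}.
  by move=> x /mapP[v _ ->]; rewrite mem_iota /= add0n sz.
have le : size (iota 0 (size ls)) <= size [seq lab v | v <- enum G].
  by rewrite size_iota size_map -cardE sz.
by have [_] := uniq_min_size U sub le.
Qed.

Lemma lab_lt v : lab v < size ls.
Proof. by case: num adjl => _ lt [-> _]. Qed.

Lemma lab_surj x : x < size ls -> exists v, x = lab v.
Proof.
move=> lt; have: x \in iota 0 (size ls) by rewrite mem_iota.
by rewrite -(perm_mem perm_lab) => /mapP[v _ ->]; exists v.
Qed.

Lemma mem_nbl v w : (lab w \in nth [::] ls (lab v)) = adj v w.
Proof.
have [_ p] := adjl; have [inj _] := num.
by rewrite (perm_mem (p v)) mem_image // inE.
Qed.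

Lemma nbl_lt u w : w \in nth [::] ls u -> w < size ls.
Proof.
case: (ltnP u (size ls)) => [/lab_surj[v ->]|le]; last by rewrite nth_default.
have [_ p] := adjl; rewrite (perm_mem (p v)) => /imageP[x _ ->].
exact: lab_lt.
Qed.

Lemma graph_sizeE : graph_size ls = \sum_(v : G) (#|nbh v|).+1.
Proof.
rewrite /graph_size -(perm_big _ perm_lab) /= big_map big_enum /=.
apply: eq_bigr => v _; have [_ p] := adjl.
by rewrite (perm_size (p v)) size_image.
Qed.

Variables ml mr : nat -> nat.
Hypothesis M : matched ls ml mr.

Let U := [set u | ml (lab u) == 0].

Definition mate u : G := odflt u [pick w | ml (lab u) == (lab w).+1].

Lemma mateP u : u \notin U ->
  ml (lab u) = (lab (mate u)).+1 /\ mr (lab (mate u)) = (lab u).+1.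
Proof.
rewrite inE /mate => nz; have [m1 m2 _] := M.
case: pickP => [w /eqP e|none] /=; first by split=> //; apply/m1; rewrite ?lab_lt.
case E : (ml (lab u)) nz none => [//|x] _.
have [w ->] := lab_surj (nbl_lt (m2 _ _ (lab_lt u) E)).
by move=> /(_ w); rewrite eqxx.
Qed.

Lemma mate_adj u : u \notin U -> adj u (mate u).
Proof.
move=> uU; have [e _] := mateP uU; rewrite -mem_nbl.
by have [_ m2 _] := M; apply: m2 => //; apply: lab_lt.
Qed.

Lemma mate_inj : {in ~: U &, injective mate}.
Proof.
have [inj _] := num.
move=> u v; rewrite !in_setC => /mateP[_ eu] /mateP[_ ev] E.
by apply: inj; move: eu; rewrite E ev => -[].
Qed.

Lemma mate_sub (X : {set G}) : mate @: (X :\: U) \subset nbhs X.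
Proof.
apply/subsetP => w /imsetP[u]; rewrite in_setD => /andP[uU uX] ->.
by apply/nbhsP; exists u => //; apply: mate_adj.
Qed.

Lemma card_mate (X : {set G}) : #|mate @: (X :\: U)| = #|X :\: U|.
Proof.
apply: card_in_imset => u v; rewrite !in_setD => /andP[uU _] /andP[vU _].
by apply: mate_inj; rewrite in_setC.
Qed.

(** Mates inject the matched part of [X] into its neighbourhood. This is the weak duality between
    matchings and |X| - |N(X)|. *)
Lemma card_le_free (X : {set G}) : #|X| <= #|U| + #|nbhs X|.
Proof.
rewrite -(cardsID U X); apply: leq_add; first by rewrite subset_leq_card ?subsetIr.
by rewrite -(card_mate X) subset_leq_card // mate_sub.
Qed.

(** A stable set attains equality in [card_le_free]: it contains all free vertices, and its
    neighbours are all mates of its members. *)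
Lemma stable_extends (S : seq nat) A :
  stable ls (clear S ml) (clear S mr) A ->
  exists X : {set G}, #|U| + #|nbhs X| <= #|X| /\
    forall v, lab v \in S -> v \in X /\ v \notin nbhs X.
Proof.
move=> [s1 s2]; pose X := [set u | A (lab u)].
have NX w : w \in nbhs X -> lab w \notin S /\ 0 < mr (lab w) /\ A (mr (lab w)).-1.
  move=> /nbhsP[u]; rewrite inE => uX; rewrite -mem_nbl => uw.
  by have := s2 _ _ (lab_lt u) uX uw; rewrite /clear; case: ifP => // _ [].
exists X; split; last first.
  move=> v vS; split; last by apply/negP => /NX[]; rewrite vS.
  by rewrite inE; apply: s1; rewrite ?lab_lt // /clear vS.
rewrite -(cardsID U X); apply: leq_add.
  apply/subset_leq_card/subsetP => u uU; rewrite inE uU andbT inE; apply: s1; rewrite ?lab_lt //.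
  by move: uU; rewrite inE /clear => /eqP->; case: ifP.
rewrite -(card_mate X) subset_leq_card //; apply/subsetP => w /NX[_ [mw Aw]].
have [m1 _ m3] := M; case E : (mr (lab w)) mw Aw => [//|x] _ /=.
have [u uE] := lab_surj (m3 _ _ E); rewrite {}uE in E * => Au.
have mu : ml (lab u) = (lab w).+1 by apply/m1; rewrite ?lab_lt.
have uU : u \notin U by rewrite inE mu.
apply/imsetP; exists u; first by rewrite in_setD uU inE.
have [inj _] := num; apply: inj.
by have [] := mateP uU; rewrite mu => -[].
Qed.

Hypothesis ex_stable : exists A, stable ls ml mr A.

(** Since a stable set exists, the maximum of |X| - |N(X)| is the number of free vertices. A
    critical [X] attains it, so both estimates in [card_le_free] are equalities, and these say that
    [X] is stable. *)
Lemma stable_extendsP (S : seq nat) :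
  (exists A, stable ls (clear S ml) (clear S mr) A) <->
  exists X : {set G}, extends [set v | lab v \in S] X.
Proof.
split=> [[A /stable_extends[X [ge SX]]]|[X [cX SX]]].
  exists X; split=> [Y|v]; last by rewrite inE => /SX.
  by move: (card_le_free Y); lia.
have [A sA] := ex_stable.
(* The case of an empty [S] supplies a set attaining the bound, to be compared with [X]. *)
have [X0 [ge0 _]] : exists X : {set G}, #|U| + #|nbhs X| <= #|X| /\
    forall v, lab v \in [::] -> v \in X /\ v \notin nbhs X.
  exact: (@stable_extends [::] A).
have le1 : #|X :&: U| <= #|U| by rewrite subset_leq_card ?subsetIr.
have le2 := subset_leq_card (mate_sub X).
move: (cX X0) (cardsID U X) (card_mate X) => c1 c2 c3.
have UX : X :&: U = U by apply/eqP; rewrite eqEcard subsetIr; lia.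
have NX : mate @: (X :\: U) = nbhs X.
  by apply/eqP; rewrite eqEcard mate_sub; lia.
exists (fun x => [exists v in X, lab v == x]); split.
  move=> x /lab_surj[u ->]; rewrite /clear => mu.
  apply/existsP; exists u; rewrite eqxx andbT.
  case: ifP mu => [uS _|_ mu]; first by have [] := SX u; rewrite ?inE.
  have : u \in U by rewrite inE mu.
  by rewrite -UX in_setI => /andP[].
move=> u x _ /existsP[v /andP[vX /eqP<-]] xv.
have [w xE] := lab_surj (nbl_lt xv); rewrite {}xE in xv *.
have wN : w \in nbhs X by apply/nbhsP; exists v; rewrite -?mem_nbl.
have wS : lab w \notin S.
  apply/negP => wS; have [|_] := SX w; first by rewrite inE.
  by rewrite wN.
rewrite /clear (negbTE wS); move: wN; rewrite -NX => /imsetP[y].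
rewrite in_setD => /andP[yU yX] ->; have [_ ->] := mateP yU; split=> //.
by apply/existsP; exists y; rewrite yX /=.
Qed.

End Transfer.

(** * Correctness and running time of the two programs *)

Section Program.
Variables (G : sgraph) (lab : G -> nat) (ls : seq (seq nat)).
Hypotheses (num : numbering lab) (adjl : adjacency_lists lab ls).

Lemma input_stored aux : stored ls (input ls aux).
Proof. by split. Qed.

Lemma run_cost_le k : connected G -> k <= #|G| -> 0 < #|edges G| ->
  matching_cost ls + (k * (select_cost ls).+2 + 2) <= 2000 * #|edges G| ^ 2.
Proof.
move=> conn kn m0; have n2 := connected_card_le conn m0.
have gs : graph_size ls <= 6 * #|edges G|.
  rewrite (graph_sizeE num adjl).
  under eq_bigr do rewrite -addn1.
  rewrite big_split /= sum1_card (_ : 6 = 4 + 2) // mulnDl.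
  exact: leq_add (sum_degrees_le G) n2.
have [nE _] := adjl.
set m := #|edges G| in m0 n2 gs *.
(* Coefficients are rounded up generously, and additive constants are absorbed by m >= 1; below, 302
   is 250 + 50 + 2 and 272 is 250 + 22. *)
have sc : search_cost ls <= 250 * m.
  rewrite /search_cost /vertex_cost /edge_cost nE.
  have -> : cmd_size init_body = 9 by [].
  by have -> : cmd_size scan_edge = 16 by []; lia.
have ac : augment_cost ls <= 50 * m.
  rewrite /augment_cost nE.
  by have -> : cmd_size augment_body = 8 by []; lia.
rewrite /matching_cost /select_cost nE.
have h1 : #|G| * (search_cost ls + augment_cost ls).+2 <= (2 * m) * (302 * m).
  by apply: leq_mul => //; lia.
have h2 : k * (20 + search_cost ls).+2 <= (2 * m) * (272 * m).
  by apply: leq_mul; lia.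
by nia.
Qed.

Lemma matching_run aux :
  runs matching (input ls aux) (matching_cost ls) (fun s =>
    [/\ stored ls s, matched ls (arr s 4) (arr s 5),
        forall w, 0 < arr s 5 w -> (arr s 5 w).-1 < size ls,
        exists A, stable ls (arr s 4) (arr s 5) A
      & frame matching (input ls aux) s]).
Proof.
have zero a : a \in [:: 4; 5] -> arr (input ls aux) a =1 (fun _ => 0).
  by move=> /= + i; rewrite !inE => /orP[]/eqP-> /=; rewrite nth_nil.
have st := input_stored aux.
have := matching_spec (nbl_lt num adjl) st (zero 4 isT) (zero 5 isT).
move=> /runs_weaken; apply=> // s f [M ex]; split=> //.
  exact: stored_frame f st.
by move=> w; case: M => _ _ /(_ w); case: (arr s 5 w) => // u /(_ u erefl).
Qed.

(** By [larson_loop_result] the output consists of the picks that pass the test, so the program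
    replays the listed picks without maintaining the set of remaining vertices. *)
Lemma larson_program picks (I : {set G}) : larson_run picks I ->
  runs (Seq matching (select true)) (input ls (map lab picks))
    (matching_cost ls + (size picks * (select_cost ls).+2 + 2))
    (outputs lab I).
Proof.
move=> /larson_loop_result[-> _]; rewrite set0U.
apply: runs_seq; apply: runs_weaken (matching_run _) (leqnn _) _.
move=> s1 _ [st M mr_lt ex [fr fa]].
have := @select_listed_spec ls (map lab picks) s1 st mr_lt.
rewrite size_map.
case=> [|i _|i|t [s2 [e lt [S [SE SP]]]]];
  rewrite ?fr ?fa //= ?size_map ?nth_nil //.
exists t, s2; split=> // v; rewrite SE; congr nat_of_bool.
have [inj _] := num.
have stP : (exists A, stable ls (upd (arr s1 4) (lab v) 0)
                               (upd (arr s1 5) (lab v) 0) A) <-> larson_test v.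
  have sE : [set u | lab u \in [:: lab v]] = [set v].
    by apply/setP => u; rewrite !inE (inj_eq inj).
  have := stable_extendsP num adjl M ex [:: lab v]; rewrite sE => xP.
  split=> [[A sA]|/larson_testP/xP[A sA]].
    apply/larson_testP/xP; exists A; apply: stable_eq sA => i;
    by rewrite clear_cons.
  by exists A; apply: stable_eq sA => i; rewrite clear_cons.
rewrite inE; apply/idP/andP => [/SP[]|[vp tv]].
  by rewrite (mem_map inj) => -> /stP.
by apply/SP; rewrite (mem_map inj); split=> //; apply/stP.
Qed.

Lemma greedy_program :
  runs (Seq matching (select false)) (input ls [::])
    (matching_cost ls + (#|G| * (select_cost ls).+2 + 2))
    (fun s => exists2 I : {set G}, max_critical_independent I & outputs lab I s).
Proof.
apply: runs_seq; apply: runs_weaken (matching_run _) (leqnn _) _.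
move=> s1 _ [st M mr_lt ex [fr fa]].
have := @select_greedy_spec ls s1 st mr_lt ex; have [<- _] := adjl.
case=> [i|t [s2 [e lt [S [SE Slt sS nS]]]]]; first by rewrite fa //= nth_nil.
exists t, s2; split=> //.
have xP := stable_extendsP num adjl M ex.
have [inj _] := num.
exists [set v | lab v \in S]; last by move=> v; rewrite SE inE.
apply: greedy_max_critical; first exact/xP.
move=> v; rewrite inE => vS [X eX].
apply: (nS _ (lab_lt num adjl v) vS); apply/xP; exists X.
rewrite (_ : [set u | _] = v |: [set u | lab u \in S]) //.
by apply/setP => u; rewrite !inE (inj_eq inj).
Qed.

End Program.

Theorem theorem1 :
  (* every run of the algorithm, whatever the choices of the vertices picked,
     is executed in time O(m^2) *)
  (exists (p : cmd) (C : nat),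
    forall (G : sgraph) (lab : G -> nat) (ls : seq (seq nat)),
      connected G -> numbering lab -> adjacency_lists lab ls ->
      forall (picks : seq G) (I : {set G}), larson_run picks I ->
      exists (t : nat) (s : state),
        [/\ exec p (input ls (map lab picks)) t s,
            outputs lab I s
          & 0 < #|edges G| -> t <= C * #|edges G| ^ 2])
  /\
  (* choosing the vertices itself, a program executes in time O(m^2) a run of
     the algorithm that returns a maximum critical independent set *)
  (exists (p : cmd) (C : nat),
    forall (G : sgraph) (lab : G -> nat) (ls : seq (seq nat)),
      connected G -> numbering lab -> adjacency_lists lab ls ->
      exists (picks : seq G) (I : {set G}) (t : nat) (s : state),
        [/\ larson_run picks I,
            max_critical_independent I,
            exec p (input ls [::]) t s,
            outputs lab I s
          & 0 < #|edges G| -> t <= C * #|edges G| ^ 2]).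
Proof.
split; [exists (Seq matching (select true)) | exists (Seq matching (select false))];
  exists 2000 => G lab ls conn num adjl.
  move=> picks I run; have [t [s [e lt out]]] := larson_program num adjl run.
  exists t, s; split=> // m0; apply: leq_trans lt (run_cost_le num adjl conn _ m0).
  by have [_] := larson_loop_result run; rewrite cardsT.
have [t [s [e lt [I mI out]]]] := greedy_program num adjl.
have [picks run] := larson_run_max_critical mI.
exists picks, I, t, s; split=> // m0.
exact: leq_trans lt (run_cost_le num adjl conn (leqnn _) m0).
Qed.
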